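(* Let $\mathbb{F}$ be a field, let $(\mathsf{P},\mu,\eta)$ be the reduced power series monad on the category $\mathbb{F}\text{-}\mathsf{VEC}$ of $\mathbb{F}$-vector spaces, let $\partial_V:\mathsf{P}(V)\to\mathsf{P}(V\times V)$ be defined, for $\mathfrak{t}=(\mathfrak{t}(n))_{n\ge1}$ with $\mathfrak{t}(n)=\sum_{i=1}^m v_{(n,i,1)}\cdots v_{(n,i,n)}$, by $$\partial_V(\mathfrak{t})(n)=\sum_{i=1}^m\sum_{j=1}^n\Big(\prod_{k\neq j}(v_{(n,i,k)},0)\Big)(0,v_{(n,i,j)}),$$ and let $\varepsilon_V:\mathsf{P}(V)\to V$ be $\varepsilon_V(\mathfrak{t})=\mathfrak{t}(1)$. Then $(\mathsf{P},\mu,\eta,\partial)$ is a Cartesian differential comonad on $\mathbb{F}\text{-}\mathsf{VEC}^{op}$ with $\mathsf{D}$-linear unit $\varepsilon$. Therefore $\mathbb{F}\text{-}\mathsf{VEC}^{op}_{\mathsf{P}}$ is a Cartesian differential category and $\mathsf{D}\text{-}\mathsf{lin}[\mathbb{F}\text{-}\mathsf{VEC}^{op}_{\mathsf{P}}]\cong\mathbb{F}\text{-}\mathsf{VEC}^{op}$.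
   Context: The monad $\mathsf{P}$. For an $\mathbb{F}$-vector space $V$, $\mathsf{P}(V)=\prod_{n=1}^\infty (V^{\otimes n})_{S(n)}$, where $(V^{\otimes n})_{S(n)}$ is the space of coinvariants of $V^{\otimes n}$ under the symmetric group $S(n)$ permuting factors; $v_1\cdots v_n$ denotes the class of $v_1\otimes\cdots\otimes v_n$. An element is a sequence $\mathfrak{t}=(\mathfrak{t}(n))_{n\ge1}$ with $\mathfrak{t}(n)\in(V^{\otimes n})_{S(n)}$, and each $\mathfrak{t}(n)$ is a finite sum $\sum_{i=1}^m v_{(n,i,1)}\cdots v_{(n,i,n)}$. Concatenation induces the commutative associative product $*:(V^{\otimes n})_{S(n)}\otimes(V^{\otimes k})_{S(k)}\to(V^{\otimes n+k})_{S(n+k)}$; juxtaposition and $\prod$ denote such products. For linear $f:V\to W$, $\mathsf{P}(f)(\mathfrak{t})(n)=\sum_i f(v_{(n,i,1)})\cdots f(v_{(n,i,n)})$. The unit is $\eta_V(v)=(v,0,0,\dots)$. For $\mathfrak{s}\in\mathsf{P}\mathsf{P}(V)$ with $\mathfrak{s}(k)=\sum_{i=1}^m\mathfrak{s}(k)_{(i,1)}\cdots\mathfrak{s}(k)_{(i,k)}$, $\mathfrak{s}(k)_{(i,j)}\in\mathsf{P}(V)$, and for $n_1+\dots+n_k=n$ with all $n_j\ge1$, put $\mathfrak{s}(n_1,\dots,n_k)=\sum_{i=1}^m\mathfrak{s}(k)_{(i,1)}(n_1)*\cdots*\mathfrak{s}(k)_{(i,k)}(n_k)$. The multiplication is $\mu_V(\mathfrak{s})(n)=\sum_{k=1}^n\sum_{n_1+\dots+n_k=n}\mathfrak{s}(n_1,\dots,n_k)$,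 the inner sum over ordered tuples of positive integers. It is known that $(\mathsf{P},\mu,\eta)$ is a monad on $\mathbb{F}\text{-}\mathsf{VEC}$. Dual notions. Let $(\mathsf{S},\mu,\eta)$ be a monad on a category $\mathbb{X}$ with finite biproducts $\times$ (projections $\pi_j$, injections $\iota_j$, diagonal $\Delta_V=\langle1_V,1_V\rangle$, copairing $[-,-]$, $c_V=\langle\pi_0\times\pi_0,\pi_1\times\pi_1\rangle$ on $(V\times V)\times(V\times V)$). A differential combinator transformation on it is a natural transformation $\partial_V:\mathsf{S}(V)\to\mathsf{S}(V\times V)$ with: [dc.1] $\mathsf{S}(\pi_0)\circ\partial_V=0$; [dc.2] $\mathsf{S}(1_V\times\Delta_V)\circ\partial_V=(\mathsf{S}(1_V\times\iota_0)+\mathsf{S}(1_V\times\iota_1))\circ\partial_V$; [dc.3] $\partial_V\circ\eta_V=\eta_{V\times V}\circ\iota_1$; [dc.4] $\partial_V\circ\mu_V=\mu_{V\times V}\circ\mathsf{S}([\mathsf{S}(\iota_0),\partial_V])\circ\partial_{\mathsf{S}(V)}$; [dc.5] $\mathsf{S}(\pi_0\times\pi_1)\circ\partial_{V\times V}\circ\partial_V=\partial_V$; [dc.6] $\mathsf{S}(c_V)\circ\partial_{V\times V}\circ\partial_V=\partial_{V\times V}\circ\partial_V$. Saying that $(\mathsf{S},\mu,\eta,\partial)$ is a Cartesian differential comonad on $\mathbb{X}^{op}$ means exactly this, and saying that a natural transformation $\varepsilon_V:\mathsf{S}(V)\to V$ is a $\mathsf{D}$-linear unit for it (on $\mathbb{X}^{op}$)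 means [du.1] $\varepsilon_V\circ\eta_V=1_V$ and [du.2] $\eta_V\circ\varepsilon_V=\mathsf{S}(\pi_1)\circ\partial_V$. The category $\mathbb{X}^{op}_{\mathsf{S}}$ is the opposite of the Kleisli category of $\mathsf{S}$ (the coKleisli category of the comonad on $\mathbb{X}^{op}$): objects as in $\mathbb{X}$; a map $A\to B$ is a map $f:B\to\mathsf{S}(A)$ of $\mathbb{X}$; the composite of $f:A\to B$ then $g:B\to C$ is $\mu_A\circ\mathsf{S}(f)\circ g:C\to\mathsf{S}(A)$; the identity is $\eta_A$. Its structure: sums and zeros of maps as in $\mathbb{X}$; product of $A,B$ is $A\times B$ with projections $\eta_{A\times B}\circ\iota_0$ and $\eta_{A\times B}\circ\iota_1$, pairing of $f:A\to\mathsf{S}(C)$ and $g:B\to\mathsf{S}(C)$ is the copairing $[f,g]$; the differential combinator sends $f:B\to\mathsf{S}(A)$ to $\mathsf{D}[f]=\partial_A\circ f:B\to\mathsf{S}(A\times A)$. Cartesian differential categories. A left additive category is a category whose hom-sets are commutative monoids such that $(f+g)\circ x=f\circ x+g\circ x$ and $0\circ x=0$; $f$ is additive if $f\circ(x+y)=f\circ x+f\circ y$ and $f\circ0=0$; a Cartesian left additive category is a left additive category with finite products whose projections are additive. In it put $\iota_0=\langle1,0\rangle$, $\iota_1=\langle0,1\rangle$, $\nabla_A=\pi_0+\pi_1$, $\ell_A=\iota_0\times\iota_1:A\times A\to(A\times A)\times(A\times A)$, $c_A=\langle\pi_0\times\pi_0,\pi_1\times\pi_1\rangle$. A Cartesian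 differential category is a Cartesian left additive category with operators sending $f:A\to B$ to $\mathsf{D}[f]:A\times A\to B$ such that: [CD.1] $\mathsf{D}[f+g]=\mathsf{D}[f]+\mathsf{D}[g]$, $\mathsf{D}[0]=0$; [CD.2] $\mathsf{D}[f]\circ(1_A\times\nabla_A)=\mathsf{D}[f]\circ(1_A\times\pi_0)+\mathsf{D}[f]\circ(1_A\times\pi_1)$, $\mathsf{D}[f]\circ\iota_0=0$; [CD.3] $\mathsf{D}[1_A]=\pi_1$, $\mathsf{D}[\pi_j]=\pi_j\circ\pi_1$; [CD.4] $\mathsf{D}[\langle f,g\rangle]=\langle\mathsf{D}[f],\mathsf{D}[g]\rangle$; [CD.5] $\mathsf{D}[g\circ f]=\mathsf{D}[g]\circ\langle f\circ\pi_0,\mathsf{D}[f]\rangle$; [CD.6] $\mathsf{D}[\mathsf{D}[f]]\circ\ell_A=\mathsf{D}[f]$; [CD.7] $\mathsf{D}[\mathsf{D}[f]]\circ c_A=\mathsf{D}[\mathsf{D}[f]]$. A map $f$ is $\mathsf{D}$-linear if $\mathsf{D}[f]=f\circ\pi_1$; $\mathsf{D}\text{-}\mathsf{lin}[\mathbb{Y}]$ is the subcategory of $\mathbb{Y}$ with the same objects and the $\mathsf{D}$-linear maps. *)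

(* Defs.v *)
From HB Require Import structures.
From mathcomp Require Import all_fingroup all_boot all_algebra.
From mathcomp Require Import boolp.
From mathcomp.multinomials Require Import freeg.

Set Implicit Arguments.
Unset Strict Implicit.
Unset Printing Implicit Defensive.

Import GRing.Theory.

Local Open Scope ring_scope.

Section LinearQuotient.
Variables (F : fieldType) (M : lmodType F) (S : M -> Prop).

Inductive in_span : M -> Prop :=
  | InSpan0 : in_span 0
  | InSpanD a u v : S u -> in_span v -> in_span (a *: u + v).

Definition linspan : {pred M} := fun x => `[< in_span x >].

Lemma linspanP x : reflect (in_span x) (x \in linspan).
Proof. exact: asboolP. Qed.

Lemma in_spanD u v : in_span u -> in_span v -> in_span (u + v).
Proof.
by move=> su sv; elim: su => [|a x y Sx _ IH];
  rewrite ?add0r // -addrA; apply: InSpanD.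
Qed.

Lemma in_spanZ a u : in_span u -> in_span (a *: u).
Proof.
elim=> [|c x y Sx _ IH]; first by rewrite scaler0; apply: InSpan0.
by rewrite scalerDr scalerA; apply: InSpanD.
Qed.

Lemma in_span_gen u : S u -> in_span u.
Proof.
by move=> Su; rewrite -[u]addr0 -[u]scale1r; apply: InSpanD => //; apply: InSpan0.
Qed.

Lemma linspan_zmod_closed : zmod_closed linspan.
Proof.
split=> [|x y /linspanP sx /linspanP sy]; first exact/linspanP/InSpan0.
by apply/linspanP/in_spanD => //; rewrite -scaleN1r; apply: in_spanZ.
Qed.

HB.instance Definition _ := GRing.isZmodClosed.Build M linspan
  linspan_zmod_closed.

Definition quotmod := Quotient.quot linspan.

HB.instance Definition _ := EqQuotient.on quotmod.
HB.instance Definition _ := GRing.Zmodule.on quotmod.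

Definition quot_class (x : M) : quotmod := \pi_quotmod%qT x.

Lemma quot_classP x y : quot_class x = quot_class y <-> in_span (x - y).
Proof.
rewrite /quot_class; split=> [E|sxy].
  by apply/linspanP; rewrite Quotient.idealrBE; apply/eqP.
by apply/eqP; rewrite -Quotient.idealrBE; apply/linspanP.
Qed.

Lemma quot_classK (q : quotmod) : quot_class (repr q) = q.
Proof. exact: reprK. Qed.

Lemma quot_classD x y : quot_class (x + y) = quot_class x + quot_class y.
Proof. by rewrite /quot_class [LHS]raddfD. Qed.

Definition quot_scale (a : F) (q : quotmod) : quotmod := quot_class (a *: repr q).

Lemma quot_scaleE a x : quot_scale a (quot_class x) = quot_class (a *: x).
Proof.
apply/quot_classP; rewrite -scalerBr; apply: in_spanZ.
by apply/quot_classP; rewrite quot_classK.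
Qed.

Fact quot_scaleA a b q : quot_scale a (quot_scale b q) = quot_scale (a * b) q.
Proof. by rewrite -(quot_classK q) !quot_scaleE scalerA. Qed.

Fact quot_scale1 : left_id 1 quot_scale.
Proof. by move=> q; rewrite -(quot_classK q) quot_scaleE scale1r. Qed.

Fact quot_scaleDr : right_distributive quot_scale +%R.
Proof.
move=> a p q; rewrite -(quot_classK p) -(quot_classK q).
by rewrite -quot_classD !quot_scaleE scalerDr quot_classD.
Qed.

Fact quot_scaleDl q : {morph quot_scale^~ q : a b / a + b}.
Proof.
by move=> a b /=; rewrite -(quot_classK q) !quot_scaleE scalerDl quot_classD.
Qed.

HB.instance Definition _ := GRing.Zmodule_isLmodule.Build F quotmod
  quot_scaleA quot_scale1 quot_scaleDr quot_scaleDl.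

Fact quot_class_linear : linear quot_class.
Proof. by move=> a x y; rewrite quot_classD -quot_scaleE. Qed.

HB.instance Definition _ := GRing.isLinear.Build F M quotmod *:%R quot_class
  quot_class_linear.

Variables (N : lmodType F) (f : {linear M -> N}).
Hypothesis f_rel : forall u, S u -> f u = 0.

Definition quot_lift_fun (q : quotmod) : N := f (repr q).

Lemma quot_lift_funE x : quot_lift_fun (quot_class x) = f x.
Proof.
have: in_span (repr (quot_class x) - x).
  by apply/quot_classP; rewrite quot_classK.
rewrite /quot_lift_fun => sx; apply/eqP; rewrite -subr_eq0 -linearB.
by elim: sx => [|a u v Su _ /eqP fv]; rewrite ?linear0 // linearP f_rel // fv
  scaler0 addr0.
Qed.

Fact quot_lift_linear : linear quot_lift_fun.
Proof.
move=> a p q; rewrite -(quot_classK p) -(quot_classK q) -linearP.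
by rewrite !quot_lift_funE linearP.
Qed.

HB.instance Definition _ := GRing.isLinear.Build F quotmod N *:%R quot_lift_fun
  quot_lift_linear.

Definition quot_lift : {linear quotmod -> N} := quot_lift_fun.

Lemma quot_liftE x : quot_lift (quot_class x) = f x.
Proof. exact: quot_lift_funE. Qed.

End LinearQuotient.

#[global] Opaque quot_class quot_lift.

Arguments quot_class {F M} S x.

Lemma linear_ext (F : fieldType) (V W : lmodType F) (f g : {linear V -> W}) :
  f =1 g -> f = g.
Proof.
case: f g => [f [[fD] [fZ]]] [g [[gD] [gZ]]] /= /funext E; subst g.
by congr (GRing.Linear.Pack (GRing.Linear.Class _ _)); congr (_ _);
  apply: Prop_irrelevance.
Qed.

Section FreeLift.
Variables (F : fieldType) (K : choiceType) (W : lmodType F) (f : K -> W).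

Fact fglift_linear : linear (fglift f : {freeg K / F} -> W).
Proof.
have liftB x y : fglift f (x - y) = fglift f x - fglift f y.
  exact: lift_is_additive.
have lift0 : fglift f 0 = 0 by rewrite -(subrr 0) liftB subrr.
have liftD x y : fglift f (x + y) = fglift f x + fglift f y.
  by rewrite -{1}[y]opprK liftB -[- y]sub0r liftB lift0 sub0r opprK.
move=> a x y; rewrite liftD; congr (_ + _).
have lift_sum (r : seq K) (G : K -> {freeg K / F}) :
    fglift f (\sum_(i <- r) G i) = \sum_(i <- r) fglift f (G i).
  by elim: r => [|i r IH]; rewrite ?big_nil // !big_cons liftD IH.
rewrite -{2}[x]freeg_sumE lift_sum [LHS]lift_sum scaler_sumr.
by apply: eq_bigr => i _; rewrite !liftU scalerA.
Qed.

HB.instance Definition _ := GRing.isLinear.Build F {freeg K / F} W *:%R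
  (fglift f) fglift_linear.

Lemma fgliftU x : fglift f (<< x >> : {freeg K / F}) = f x.
Proof. by rewrite liftU scale1r. Qed.

End FreeLift.

Section TensorPower.
Variables (F : fieldType) (V : lmodType F) (n : nat).

Definition tupd (v : n.-tuple V) (i : 'I_n) (x : V) : n.-tuple V :=
  [tuple if k == i then x else tnth v k | k < n].

(* This is the action of the inverse of [s] on factors, in the usual left-action
   convention; the coinvariants do not depend on the choice. *)
Definition tperm_fac (v : n.-tuple V) (s : 'S_n) : n.-tuple V :=
  [tuple tnth v (s k) | k < n].

Definition multilinear (W : lmodType F) (f : n.-tuple V -> W) : Prop :=
  forall v i a x y,
    f (tupd v i (a *: x + y)) = a *: f (tupd v i x) + f (tupd v i y).

Definition symmetric_map (W : lmodType F) (f : n.-tuple V -> W) : Prop :=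
  forall v s, f (tperm_fac v s) = f v.

Definition multilinear_rel (w : {freeg (n.-tuple V) / F}) : Prop :=
  exists v i a x y, w = << tupd v i (a *: x + y) >>
    - (a *: << tupd v i x >> + << tupd v i y >>).

Definition tensor : lmodType F := quotmod multilinear_rel.

Definition tens (v : n.-tuple V) : tensor := quot_class multilinear_rel << v >>.

Section Lift.
Variables (W : lmodType F) (f : n.-tuple V -> W).
Hypothesis f_lin : multilinear f.

Fact tensor_lift_rel (w : {freeg (n.-tuple V) / F}) :
  multilinear_rel w -> fglift f w = 0.
Proof.
case=> v [i [a [x [y ->]]]].
by rewrite linearB linearP /= !fgliftU f_lin subrr.
Qed.

Definition tensor_lift : {linear tensor -> W} := quot_lift tensor_lift_rel.

Lemma tensor_liftE v : tensor_lift (tens v) = f v.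
Proof. by rewrite [LHS]quot_liftE [LHS]fgliftU. Qed.

End Lift.

Lemma tens_multilinear : multilinear tens.
Proof.
move=> v i a x y; rewrite /tens -linearP; apply/quot_classP/in_span_gen.
by exists v, i, a, x, y.
Qed.

Lemma tperm_fac_upd v i x s :
  tperm_fac (tupd v i x) s = tupd (tperm_fac v s) (s^-1 i)%g x.
Proof.
apply: eq_from_tnth => k; rewrite !tnth_mktuple.
by rewrite -[in RHS](inj_eq (@perm_inj _ s)) permKV.
Qed.

Lemma tens_perm_multilinear (s : 'S_n) : multilinear (fun v => tens (tperm_fac v s)).
Proof. by move=> v i a x y; rewrite !tperm_fac_upd tens_multilinear. Qed.

Definition tensor_perm (s : 'S_n) : {linear tensor -> tensor} :=
  tensor_lift (tens_perm_multilinear s).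

Lemma tensor_permE s v : tensor_perm s (tens v) = tens (tperm_fac v s).
Proof. exact: tensor_liftE. Qed.

Definition coinvariant_rel (w : tensor) : Prop :=
  exists t s, w = tensor_perm s t - t.

Definition coinv : lmodType F := quotmod coinvariant_rel.

Definition mon (v : n.-tuple V) : coinv := quot_class coinvariant_rel (tens v).

Lemma mon_multilinear : multilinear mon.
Proof. by move=> v i a x y; rewrite /mon tens_multilinear linearP. Qed.

Lemma mon_symmetric : symmetric_map mon.
Proof.
move=> v s; apply/quot_classP/in_span_gen; exists (tens v), s.
by rewrite tensor_permE.
Qed.

Lemma tensor_ext (W : lmodType F) (f g : {linear tensor -> W}) :
  (forall v, f (tens v) = g (tens v)) -> f =1 g.
Proof.
move=> fg q; rewrite -(quot_classK q) -[repr q]freeg_sumE !linear_sum.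
apply: eq_bigr => v _.
have -> : << coeff v (repr q) *g v >> = coeff v (repr q) *: << v >> :> {freeg _ / F}.
  by apply/eqP/freeg_eqP => x; rewrite coeffZ !coeffU mul1r.
by rewrite !linearZ; congr (_ *: _); apply: fg.
Qed.

Lemma coinv_ext (W : lmodType F) (f g : {linear coinv -> W}) :
  (forall v, f (mon v) = g (mon v)) -> f =1 g.
Proof.
move=> fg q; rewrite -(quot_classK q).
by apply: (@tensor_ext W (f \o quot_class coinvariant_rel)
                         (g \o quot_class coinvariant_rel)).
Qed.

Lemma coinv_ext_lin (W : lmodType F) (f g h : {linear coinv -> W}) a :
  (forall v, f (mon v) = a *: g (mon v) + h (mon v)) ->
  forall q, f q = a *: g q + h q.
Proof. by move=> fgh; apply: (coinv_ext (g := (a \*: g) \+ h)). Qed.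

Section CoinvLift.
Variables (W : lmodType F) (f : n.-tuple V -> W).
Hypotheses (f_lin : multilinear f) (f_sym : symmetric_map f).

Fact coinv_lift_rel (w : tensor) : coinvariant_rel w -> tensor_lift f_lin w = 0.
Proof.
case=> t [s ->]; rewrite linearB; apply/eqP; rewrite subr_eq0; apply/eqP.
move: t; apply: (@tensor_ext W (tensor_lift f_lin \o tensor_perm s)) => v.
rewrite -[LHS]/(tensor_lift f_lin (tensor_perm s (tens v))).
by rewrite tensor_permE !tensor_liftE f_sym.
Qed.

Definition coinv_lift : {linear coinv -> W} := quot_lift coinv_lift_rel.

Lemma coinv_liftE v : coinv_lift (mon v) = f v.
Proof. by rewrite [LHS]quot_liftE tensor_liftE. Qed.

End CoinvLift.

End TensorPower.

#[global] Opaque tens tensor_lift tensor_perm mon coinv_lift.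
Arguments tens {F V n} v.
Arguments mon {F V n} v.
Arguments multilinear {F V n W} f.
Arguments symmetric_map {F V n W} f.
Arguments coinv {F} V n.
Arguments tensor {F} V n.

Section EntrywiseMaps.
Variables (F : fieldType) (V W : lmodType F) (n : nat).

Lemma mon_map_multilinear (g : 'I_n -> {linear V -> W}) :
  multilinear (fun v : n.-tuple V => mon [tuple g k (tnth v k) | k < n]).
Proof.
have E v i x : [tuple g k (tnth (tupd v i x) k) | k < n]
    = tupd [tuple g k (tnth v k) | k < n] i (g i x).
  by apply: eq_from_tnth => k; rewrite !tnth_mktuple; case: eqP => [->|].
by move=> v i a x y; rewrite !E linearP mon_multilinear.
Qed.

Lemma sum_multilinear (U : lmodType F) (I : Type) (r : seq I) (P : pred I)
    (f : I -> n.-tuple V -> U) :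
  (forall i, multilinear (f i)) -> multilinear (fun v => \sum_(i <- r | P i) f i v).
Proof.
move=> fl v i a x y; rewrite scaler_sumr -big_split.
by apply: eq_bigr => j _; apply: fl.
Qed.

Lemma mon_map_symmetric (f : {linear V -> W}) :
  symmetric_map (fun v : n.-tuple V => mon [tuple f (tnth v k) | k < n]).
Proof.
move=> v s; rewrite -(mon_symmetric [tuple f (tnth v k) | k < n] s).
by congr mon; apply: eq_from_tnth => k; rewrite !tnth_mktuple.
Qed.

Definition coinv_map (f : {linear V -> W}) : {linear coinv V n -> coinv W n} :=
  coinv_lift (mon_map_multilinear (fun=> f)) (mon_map_symmetric f).

Lemma coinv_mapE f v : coinv_map f (mon v) = mon [tuple f (tnth v k) | k < n].
Proof. exact: coinv_liftE. Qed.

End EntrywiseMaps.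

Section ConcatProduct.
Variables (F : fieldType) (V : lmodType F).

(* Classes of tuples as elements of the disjoint union of the coinvariant
   spaces, which makes associativity and commutativity plain equalities. *)
Local Notation tcoinv := {n : nat & coinv V n}.

Definition tmon (s : seq V) : tcoinv := Tagged (coinv V) (mon (in_tuple s)).

Lemma tmonE n (v : n.-tuple V) : tmon v = Tagged (coinv V) (mon v).
Proof.
case: v => s i; move: (i); rewrite /tmon; move/eqP: (i) => E; subst n => j.
by rewrite (_ : Tuple j = in_tuple s) //; apply: val_inj.
Qed.

Lemma tmon_perm s t : perm_eq s t -> tmon s = tmon t.
Proof.
move=> st; have ss := perm_size st.
have /tuple_permP [p E] : perm_eq s (tcast (esym ss) (in_tuple t)).
  by rewrite val_tcast.
rewrite -[t](val_tcast (esym ss) (in_tuple t)) tmonE -(mon_symmetric _ p).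
by rewrite -tmonE; congr tmon.
Qed.

Lemma mon_cat_sym m n (v v' : m.-tuple V) (w w' : n.-tuple V) :
  perm_eq (v ++ w) (v' ++ w') -> mon [tuple of v ++ w] = mon [tuple of v' ++ w'].
Proof. by move/tmon_perm; rewrite !tmonE; apply: eq_from_Tagged. Qed.

Lemma tperm_fac_perm n (v : n.-tuple V) s : perm_eq (tperm_fac v s) v.
Proof. by apply/tuple_permP; exists s. Qed.

Lemma cat_updl m n (v : m.-tuple V) (w : n.-tuple V) i x :
  [tuple of tupd v i x ++ w] = tupd [tuple of v ++ w] (lshift n i) x.
Proof.
apply: eq_from_tnth => k; rewrite tnth_mktuple; case: (split_ordP k) => j ->.
  by rewrite !tnth_lshift tnth_mktuple eq_lshift.
by rewrite !tnth_rshift eq_rlshift.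
Qed.

Lemma cat_updr m n (v : m.-tuple V) (w : n.-tuple V) i x :
  [tuple of v ++ tupd w i x] = tupd [tuple of v ++ w] (rshift m i) x.
Proof.
apply: eq_from_tnth => k; rewrite tnth_mktuple; case: (split_ordP k) => j ->.
  by rewrite !tnth_lshift eq_lrshift.
by rewrite !tnth_rshift tnth_mktuple eq_rshift.
Qed.

Section Product.
Variables m n : nat.

Fact smul_r_multilinear (v : m.-tuple V) :
  multilinear (fun w : n.-tuple V => mon [tuple of v ++ w]).
Proof. by move=> w i a x y; rewrite !cat_updr mon_multilinear. Qed.

Fact smul_r_symmetric (v : m.-tuple V) :
  symmetric_map (fun w : n.-tuple V => mon [tuple of v ++ w]).
Proof.
by move=> w s; apply: mon_cat_sym; rewrite perm_cat2l tperm_fac_perm.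
Qed.

Definition smul_r (v : m.-tuple V) : {linear coinv V n -> coinv V (m + n)} :=
  coinv_lift (smul_r_multilinear v) (smul_r_symmetric v).

Lemma smul_rE v w : smul_r v (mon w) = mon [tuple of v ++ w].
Proof. exact: coinv_liftE. Qed.

Opaque smul_r.

Fact smul_l_multilinear (y : coinv V n) : multilinear (smul_r^~ y).
Proof.
move=> v i a x x'.
apply: coinv_ext_lin => w.
by rewrite !smul_rE !cat_updl mon_multilinear.
Qed.

Fact smul_l_symmetric (y : coinv V n) : symmetric_map (smul_r^~ y).
Proof.
move=> v s.
apply: (coinv_ext (f := smul_r (tperm_fac v s)) (g := smul_r v)) => w.
by rewrite !smul_rE; apply: mon_cat_sym; rewrite perm_cat2r tperm_fac_perm.
Qed.

Definition smul_l (y : coinv V n) : {linear coinv V m -> coinv V (m + n)} :=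
  coinv_lift (smul_l_multilinear y) (smul_l_symmetric y).

Lemma smul_lE y v : smul_l y (mon v) = smul_r v y.
Proof. exact: coinv_liftE. Qed.

Opaque smul_l.

Definition smul (x : coinv V m) (y : coinv V n) : coinv V (m + n) := smul_l y x.

Lemma smul_mon (v : m.-tuple V) (w : n.-tuple V) :
  smul (mon v) (mon w) = mon [tuple of v ++ w].
Proof. by rewrite /smul smul_lE smul_rE. Qed.

Fact smul_linearr (x : coinv V m) : linear (smul x).
Proof.
move=> a y y'; rewrite /smul.
apply: coinv_ext_lin => v.
by rewrite !smul_lE linearP.
Qed.

HB.instance Definition _ x := GRing.isLinear.Build F _ _ *:%R (smul x)
  (smul_linearr x).

End Product.

Definition tsmul (x y : tcoinv) : tcoinv :=
  Tagged (fun n => coinv V n) (smul (tagged x) (tagged y)).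

Definition tsone : tcoinv := tmon [::].

(* The part of degree [n] of a homogeneous element, hence 0 if its degree is
   not [n]. *)
Definition tcomp (n : nat) (u : tcoinv) : coinv V n :=
  @untag nat (fun n => coinv V n) (coinv V n) 0 n id u.

Lemma tcompE n (x : coinv V n) : tcomp n (Tagged (fun n => coinv V n) x) = x.
Proof. by rewrite /tcomp (untagE _ _ (erefl : tag (Tagged (fun n => coinv V n) x) = n)).
Qed.

Lemma tcomp_dflt m n (x : coinv V m) :
  m != n -> tcomp n (Tagged (fun n => coinv V n) x) = 0.
Proof. by move=> ne; rewrite /tcomp untag_dflt. Qed.

Lemma tsmul_tmon s t : tsmul (tmon s) (tmon t) = tmon (s ++ t).
Proof. by rewrite /tsmul /= smul_mon -tmonE. Qed.

Definition cast_coinv m n (x : coinv V m) : coinv V n :=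
  tcomp n (Tagged (fun n => coinv V n) x).

Fact cast_coinv_linear m n : linear (@cast_coinv m n).
Proof.
rewrite /cast_coinv => a x y; case: (eqVneq m n) => [E|ne].
  by subst n; rewrite !tcompE.
by rewrite !tcomp_dflt ?scaler0 ?addr0.
Qed.

HB.instance Definition _ m n := GRing.isLinear.Build F _ _ *:%R
  (@cast_coinv m n) (@cast_coinv_linear m n).

Lemma cast_coinv_mon m n (v : m.-tuple V) (w : n.-tuple V) :
  perm_eq v w -> cast_coinv n (mon v) = mon w.
Proof.
move=> vw; rewrite /cast_coinv; have := tmon_perm vw.
by rewrite !tmonE => ->; apply: tcompE.
Qed.

Lemma tcoinv_eq (u v : tcoinv) :
  tag u = tag v -> cast_coinv (tag v) (tagged u) = tagged v -> u = v.
Proof.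
case: u v => m x [n y] /= E; subst n.
by rewrite /cast_coinv tcompE => ->.
Qed.

Lemma tsmulA : associative tsmul.
Proof.
move=> [m x] [n y] [p z]; apply: tcoinv_eq => /=; first exact: addnA.
apply: (coinv_ext (f := @cast_coinv _ (m + n + p) \o smul_l m (smul y z))
          (g := smul_l _ z \o smul_l m y)) x => u /=.
rewrite -!/(smul _ _).
apply: (coinv_ext (f := @cast_coinv _ (m + n + p) \o smul (mon u) \o smul_l n z)
          (g := smul_l _ z \o smul (mon u))) y => v /=.
rewrite -!/(smul _ _).
apply: (coinv_ext (f := @cast_coinv _ (m + n + p) \o smul (mon u) \o smul (mon v))
          (g := smul (smul (mon u) (mon v)))) z => w /=.
by rewrite !smul_mon; apply: cast_coinv_mon; rewrite /= catA.
Qed.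

Lemma tsmulC : commutative tsmul.
Proof.
move=> [m x] [n y]; apply: tcoinv_eq => /=; first exact: addnC.
apply: (coinv_ext (f := @cast_coinv _ (n + m) \o smul_l m y) (g := smul y)) x.
move=> u /=; rewrite -!/(smul _ _).
apply: (coinv_ext (f := @cast_coinv _ (n + m) \o smul (mon u))
          (g := smul_l n (mon u))) y => v /=.
by rewrite -/(smul _ _) !smul_mon; apply: cast_coinv_mon; rewrite /= perm_catC.
Qed.

Lemma tsmul1 : left_id tsone tsmul.
Proof.
move=> [n y]; apply: tcoinv_eq => //=.
apply: (coinv_ext (f := @cast_coinv _ n \o smul (mon (in_tuple [::])))
          (g := idfun)) y.
by move=> v /=; rewrite smul_mon; apply: cast_coinv_mon.
Qed.

HB.instance Definition _ := Monoid.isComLaw.Build tcoinv tsone tsmul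
  tsmulA tsmulC tsmul1.

End ConcatProduct.

Declare Scope cat_scope.
Delimit Scope cat_scope with cat.

Record category := Category {
  ob :> Type;
  mor : ob -> ob -> Type;
  idm : forall A, mor A A;
  mcomp : forall A B C, mor B C -> mor A B -> mor A C;
  compm1 : forall A B (f : mor A B), mcomp f (idm A) = f;
  comp1m : forall A B (f : mor A B), mcomp (idm B) f = f;
  compA : forall A B C D (h : mor C D) (g : mor B C) (f : mor A B),
    mcomp h (mcomp g f) = mcomp (mcomp h g) f }.
Arguments mor {c} A B.
Arguments idm {c} A.
Arguments mcomp {c A B C} g f.

Notation "g \circ f" := (mcomp g f) (at level 40, left associativity) : cat_scope.

Local Open Scope cat_scope.

Record functor (C D : category) := Functor {
  fob :> C -> D;
  fmap : forall A B, mor A B -> mor (fob A) (fob B);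
  fmap1 : forall A, fmap (idm A) = idm (fob A);
  fmapM : forall A B E (g : mor B E) (f : mor A B),
    fmap (g \circ f) = fmap g \circ fmap f }.
Arguments fmap {C D} _ {A B} _.

Definition functor_id (C : category) : functor C C.
Proof. by exists id (fun A B f => f). Defined.

Definition functor_comp (C D E : category) (G : functor D E) (H : functor C D) :
  functor C E.
Proof.
exists (fun A => G (H A)) (fun A B f => fmap G (fmap H f)).
- by move=> A; rewrite !fmap1.
- by move=> A B X g f; rewrite !fmapM.
Defined.

Definition isomorphic_categories (C D : category) : Prop :=
  exists (G : functor C D) (H : functor D C),
    functor_comp H G = functor_id C /\ functor_comp G H = functor_id D.

Definition op_category (C : category) : category.
Proof.
exists C (fun A B => @mor C B A) (fun A => idm A)
  (fun A B E (g : @mor C E B) (f : @mor C B A) => f \circ g).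
- by move=> A B f; apply: comp1m.
- by move=> A B f; apply: compm1.
- by move=> A B E D h g f; rewrite compA.
Defined.

Record hom_monoids (C : category) := HomMonoids {
  hadd : forall A B : C, mor A B -> mor A B -> mor A B;
  hzero : forall A B : C, mor A B;
  haddA : forall A B (f g h : mor A B), hadd f (hadd g h) = hadd (hadd f g) h;
  haddC : forall A B (f g : mor A B), hadd f g = hadd g f;
  hadd0 : forall A B (f : mor A B), hadd f (hzero A B) = f }.
Arguments hadd {C} _ {A B} f g.
Arguments hzero {C} _ A B.

Record biproducts (X : category) := Biproducts {
  bp_add :> hom_monoids X;
  bp_compDl : forall A B C (f g : mor B C) (x : mor A B),
    hadd bp_add f g \circ x = hadd bp_add (f \circ x) (g \circ x);
  bp_compDr : forall A B C (f : mor B C) (x y : mor A B),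
    f \circ hadd bp_add x y = hadd bp_add (f \circ x) (f \circ y);
  bp_comp0l : forall A B C (x : mor A B),
    hzero bp_add B C \circ x = hzero bp_add A C;
  bp_comp0r : forall A B C (f : mor B C),
    f \circ hzero bp_add A B = hzero bp_add A C;
  bp_null : X;
  bp_to_null : forall A (f : mor A bp_null), f = hzero bp_add A bp_null;
  bp_from_null : forall A (f : mor bp_null A), f = hzero bp_add bp_null A;
  bp_prod : X -> X -> X;
  bp_pi0 : forall A B, mor (bp_prod A B) A;
  bp_pi1 : forall A B, mor (bp_prod A B) B;
  bp_in0 : forall A B, mor A (bp_prod A B);
  bp_in1 : forall A B, mor B (bp_prod A B);
  bp_pi0in0 : forall A B, bp_pi0 A B \circ bp_in0 A B = idm A;
  bp_pi1in1 : forall A B, bp_pi1 A B \circ bp_in1 A B = idm B;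
  bp_pi0in1 : forall A B, bp_pi0 A B \circ bp_in1 A B = hzero bp_add B A;
  bp_pi1in0 : forall A B, bp_pi1 A B \circ bp_in0 A B = hzero bp_add A B;
  bp_inpi : forall A B,
    hadd bp_add (bp_in0 A B \circ bp_pi0 A B) (bp_in1 A B \circ bp_pi1 A B)
      = idm (bp_prod A B) }.
Arguments bp_prod {X} _ A B.
Arguments bp_pi0 {X} _ A B.
Arguments bp_pi1 {X} _ A B.
Arguments bp_in0 {X} _ A B.
Arguments bp_in1 {X} _ A B.

Section BiproductMaps.
Variables (X : category) (b : biproducts X).

Definition bp_pair (A B C : X) (f : mor C A) (g : mor C B) :
    mor C (bp_prod b A B) :=
  hadd b (bp_in0 b A B \circ f) (bp_in1 b A B \circ g).

Definition bp_copair (A B C : X) (f : mor A C) (g : mor B C) :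
    mor (bp_prod b A B) C :=
  hadd b (f \circ bp_pi0 b A B) (g \circ bp_pi1 b A B).

Definition bp_map (A B A' B' : X) (f : mor A A') (g : mor B B') :
    mor (bp_prod b A B) (bp_prod b A' B') :=
  bp_pair (f \circ bp_pi0 b A B) (g \circ bp_pi1 b A B).

Definition bp_diag (A : X) : mor A (bp_prod b A A) := bp_pair (idm A) (idm A).

Definition bp_flip (A : X) :
    mor (bp_prod b (bp_prod b A A) (bp_prod b A A))
        (bp_prod b (bp_prod b A A) (bp_prod b A A)) :=
  bp_pair (bp_map (bp_pi0 b A A) (bp_pi0 b A A))
          (bp_map (bp_pi1 b A A) (bp_pi1 b A A)).

Lemma bp_copair_in0 (A B C : X) (f : mor A C) (g : mor B C) :
  bp_copair f g \circ bp_in0 b A B = f.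
Proof.
by rewrite bp_compDl -!compA bp_pi0in0 bp_pi1in0 compm1 bp_comp0r hadd0.
Qed.

Lemma bp_copair_in1 (A B C : X) (f : mor A C) (g : mor B C) :
  bp_copair f g \circ bp_in1 b A B = g.
Proof.
by rewrite bp_compDl -!compA bp_pi0in1 bp_pi1in1 compm1 bp_comp0r haddC hadd0.
Qed.

Lemma bp_copair_uniq (A B C : X) (h : mor (bp_prod b A B) C) :
  h = bp_copair (h \circ bp_in0 b A B) (h \circ bp_in1 b A B).
Proof. by rewrite /bp_copair -!compA -bp_compDr bp_inpi compm1. Qed.

End BiproductMaps.

Record monad_data (X : category) := MonadData {
  mfun :> functor X X;
  mmul : forall A : X, mor (mfun (mfun A)) (mfun A);
  munit : forall A : X, mor A (mfun A) }.
Arguments mmul {X} _ A.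
Arguments munit {X} _ A.

Record is_monad (X : category) (S : monad_data X) : Prop := IsMonad {
  mmul_nat : forall (A B : X) (f : mor A B),
    fmap S f \circ mmul S A = mmul S B \circ fmap S (fmap S f);
  munit_nat : forall (A B : X) (f : mor A B),
    fmap S f \circ munit S A = munit S B \circ f;
  mmul_unitl : forall A : X, mmul S A \circ munit S (S A) = idm (S A);
  mmul_unitr : forall A : X, mmul S A \circ fmap S (munit S A) = idm (S A);
  mmulA : forall A : X,
    mmul S A \circ mmul S (S A) = mmul S A \circ fmap S (mmul S A) }.

Section DifferentialCombinator.
Variables (X : category) (b : biproducts X) (S : monad_data X).
Variable d : forall V : X, mor (S V) (S (bp_prod b V V)).

Local Notation "A ** B" := (bp_prod b A B) (at level 40, left associativity).

Record is_differential_combinator : Prop := IsDifferentialCombinator {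
  dc_nat : forall (V W : X) (f : mor V W),
    fmap S (bp_map b f f) \circ d V = d W \circ fmap S f;
  dc1 : forall V : X, fmap S (bp_pi0 b V V) \circ d V = hzero b (S V) (S V);
  dc2 : forall V : X,
    fmap S (bp_map b (idm V) (bp_diag b V)) \circ d V
      = hadd b (fmap S (bp_map b (idm V) (bp_in0 b V V)))
               (fmap S (bp_map b (idm V) (bp_in1 b V V))) \circ d V;
  dc3 : forall V : X, d V \circ munit S V = munit S (V ** V) \circ bp_in1 b V V;
  dc4 : forall V : X,
    d V \circ mmul S V
      = mmul S (V ** V) \circ fmap S (bp_copair b (fmap S (bp_in0 b V V)) (d V))
          \circ d (S V);
  dc5 : forall V : X,
    fmap S (bp_map b (bp_pi0 b V V) (bp_pi1 b V V)) \circ d (V ** V) \circ d V = d V;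
  dc6 : forall V : X,
    fmap S (bp_flip b V) \circ d (V ** V) \circ d V = d (V ** V) \circ d V }.

(* [(S, mu, eta, d)] is a Cartesian differential comonad on the opposite of
   [X], spelled out in [X]; likewise for the D-linear unit below. *)
Definition is_cartesian_differential_comonad_op : Prop :=
  is_monad S /\ is_differential_combinator.

Record is_D_linear_unit_op (e : forall V : X, mor (S V) V) : Prop :=
  IsDLinearUnit {
  du_nat : forall (V W : X) (f : mor V W), f \circ e V = e W \circ fmap S f;
  du1 : forall V : X, e V \circ munit S V = idm V;
  du2 : forall V : X, munit S V \circ e V = fmap S (bp_pi1 b V V) \circ d V }.

End DifferentialCombinator.
Arguments is_differential_combinator {X} _ _ _.
Arguments is_cartesian_differential_comonad_op {X} _ _ _.
Arguments is_D_linear_unit_op {X} _ _ _ _.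

Definition additive_map (Y : category) (m : hom_monoids Y) (A B : Y)
    (f : mor A B) : Prop :=
  (forall (C : Y) (x y : mor C A), f \circ hadd m x y = hadd m (f \circ x) (f \circ y)) /\
  (forall C : Y, f \circ hzero m C A = hzero m C B).

Record cartesian_left_additive (Y : category) := CartesianLeftAdditive {
  la_add :> hom_monoids Y;
  la_compD : forall A B C (f g : mor B C) (x : mor A B),
    hadd la_add f g \circ x = hadd la_add (f \circ x) (g \circ x);
  la_comp0 : forall A B C (x : mor A B),
    hzero la_add B C \circ x = hzero la_add A C;
  la_one : Y;
  la_bang : forall A, mor A la_one;
  la_bang_uniq : forall A (f : mor A la_one), f = la_bang A;
  la_prod : Y -> Y -> Y;
  la_pi0 : forall A B, mor (la_prod A B) A;
  la_pi1 : forall A B, mor (la_prod A B) B;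
  la_pair : forall A B C, mor C A -> mor C B -> mor C (la_prod A B);
  la_pi0_pair : forall A B C (f : mor C A) (g : mor C B),
    la_pi0 A B \circ la_pair f g = f;
  la_pi1_pair : forall A B C (f : mor C A) (g : mor C B),
    la_pi1 A B \circ la_pair f g = g;
  la_pair_uniq : forall A B C (h : mor C (la_prod A B)),
    h = la_pair (la_pi0 A B \circ h) (la_pi1 A B \circ h);
  la_pi0_additive : forall A B, additive_map la_add (la_pi0 A B);
  la_pi1_additive : forall A B, additive_map la_add (la_pi1 A B) }.
Arguments la_prod {Y} _ A B.
Arguments la_pi0 {Y} _ A B.
Arguments la_pi1 {Y} _ A B.
Arguments la_pair {Y} _ {A B C} f g.

Section CartesianDifferential.
Variables (Y : category) (L : cartesian_left_additive Y).

Local Notation "A ** B" := (la_prod L A B) (at level 40, left associativity).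
Local Notation "f + g" := (hadd L f g) : cat_scope.
Local Notation "0" := (hzero L _ _) : cat_scope.
Local Notation "<< f ; g >>" := (la_pair L f g) : cat_scope.
Local Notation pi0 := (la_pi0 L _ _).
Local Notation pi1 := (la_pi1 L _ _).

Definition la_map (A B A' B' : Y) (f : mor A A') (g : mor B B') :
    mor (A ** B) (A' ** B') :=
  << f \circ pi0 ; g \circ pi1 >>.

Definition la_in0 (A : Y) : mor A (A ** A) := << idm A ; 0 >>.
Definition la_in1 (A : Y) : mor A (A ** A) := << 0 ; idm A >>.
Definition la_nabla (A : Y) : mor (A ** A) A := pi0 + pi1.
Definition la_lift (A : Y) : mor (A ** A) ((A ** A) ** (A ** A)) :=
  la_map (la_in0 A) (la_in1 A).
Definition la_flip (A : Y) :
    mor ((A ** A) ** (A ** A)) ((A ** A) ** (A ** A)) :=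
  << la_map pi0 pi0 ; la_map pi1 pi1 >>.

Variable D : forall A B : Y, mor A B -> mor (A ** A) B.

Record is_cartesian_differential : Prop := IsCartesianDifferential {
  CD1_add : forall (A B : Y) (f g : mor A B), D (f + g) = D f + D g;
  CD1_zero : forall A B : Y, D (hzero L A B) = 0;
  CD2_add : forall (A B : Y) (f : mor A B),
    D f \circ la_map (idm A) (la_nabla A)
      = D f \circ la_map (idm A) pi0 + D f \circ la_map (idm A) pi1;
  CD2_zero : forall (A B : Y) (f : mor A B), D f \circ la_in0 A = 0;
  CD3_id : forall A : Y, D (idm A) = pi1;
  CD3_pi0 : forall A B : Y, D (la_pi0 L A B) = pi0 \circ pi1;
  CD3_pi1 : forall A B : Y, D (la_pi1 L A B) = pi1 \circ pi1;
  CD4 : forall (A B C : Y) (f : mor C A) (g : mor C B),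
    D << f ; g >> = << D f ; D g >>;
  CD5 : forall (A B C : Y) (g : mor B C) (f : mor A B),
    D (g \circ f) = D g \circ << f \circ pi0 ; D f >>;
  CD6 : forall (A B : Y) (f : mor A B), D (D f) \circ la_lift A = D f;
  CD7 : forall (A B : Y) (f : mor A B), D (D f) \circ la_flip A = D (D f) }.

Definition D_linear (A B : Y) (f : mor A B) : Prop := D f = f \circ pi1.

Hypothesis cdD : is_cartesian_differential.

Lemma D_linear_id (A : Y) : D_linear (idm A).
Proof. by rewrite /D_linear CD3_id // comp1m. Qed.

Lemma D_linear_comp (A B C : Y) (g : mor B C) (f : mor A B) :
  D_linear g -> D_linear f -> D_linear (g \circ f).
Proof.
by rewrite /D_linear CD5 // => -> ->; rewrite -compA la_pi1_pair compA.
Qed.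

Definition D_lin_category : category.
Proof.
exists Y (fun A B => {f : mor A B | D_linear f})
  (fun A => exist _ (idm A) (D_linear_id A))
  (fun A B C g f => exist _ (sval g \circ sval f)
                      (D_linear_comp (svalP g) (svalP f))).
- by move=> A B [f hf]; apply: eq_exist; rewrite /= compm1.
- by move=> A B [f hf]; apply: eq_exist; rewrite /= comp1m.
- by move=> A B C E h g f; apply: eq_exist; rewrite /= compA.
Defined.

End CartesianDifferential.
Arguments is_cartesian_differential {Y} _ _.
Arguments D_lin_category {Y L D} _.

Section KleisliOp.
Variables (X : category) (S : monad_data X) (mS : is_monad S).

(* A map from [A] to [B] is a map from [B] to [S A] in [X]. *)
Definition kleisli_op : category.
Proof.
exists X (fun A B => @mor X B (S A)) (fun A => munit S A)
  (fun A B C (g : @mor X C (S B)) (f : @mor X B (S A)) =>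
     mmul S A \circ fmap S f \circ g).
- by move=> A B f; rewrite mmul_unitr // comp1m.
- by move=> A B f; rewrite -compA munit_nat // compA mmul_unitl // comp1m.
- move=> A B C D h g f; rewrite !fmapM !compA.
  by rewrite -mmulA // -(compA (mmul S A) (mmul S (S A))) -mmul_nat // !compA.
Defined.

Variable b : biproducts X.

Definition kleisli_op_hom_monoids : hom_monoids kleisli_op.
Proof.
apply: (@HomMonoids kleisli_op
  (fun A B (f g : @mor X B (S A)) => hadd b f g)
  (fun A B => hzero b B (S A))).
- by move=> A B; apply: (@haddA X b B (S A)).
- by move=> A B; apply: (@haddC X b B (S A)).
- by move=> A B; apply: (@hadd0 X b B (S A)).
Defined.

Definition kleisli_op_cla : cartesian_left_additive kleisli_op.
Proof.
refine (@CartesianLeftAdditive kleisli_op kleisli_op_hom_monoids _ _ (bp_null b)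
  (fun A => hzero b (bp_null b) (S A)) _ (bp_prod b)
  (fun A B => munit S (bp_prod b A B) \circ bp_in0 b A B)
  (fun A B => munit S (bp_prod b A B) \circ bp_in1 b A B)
  (fun A B C (f : @mor X A (S C)) (g : @mor X B (S C)) => bp_copair b f g)
  _ _ _ _ _).
- by move=> A B C f g x; rewrite /= bp_compDr.
- by move=> A B C x; rewrite /= bp_comp0r.
- by move=> A f; apply: bp_from_null.
- move=> A B C f g /=.
  by rewrite -!compA (compA (fmap S _)) munit_nat // -compA compA mmul_unitl //
             comp1m bp_copair_in0.
- move=> A B C f g /=.
  by rewrite -!compA (compA (fmap S _)) munit_nat // -compA compA mmul_unitl //
             comp1m bp_copair_in1.
- move=> A B C h /=.
  by rewrite -!compA !(compA (fmap S h)) munit_nat // -!compA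
             !(compA (mmul S C)) mmul_unitl // !comp1m -bp_copair_uniq.
- move=> A B; have E (C : X) (h : mor (bp_prod b A B) (S C)) :
    mmul S C \circ fmap S h \circ (munit S (bp_prod b A B) \circ bp_in0 b A B)
      = h \circ bp_in0 b A B.
    by rewrite -!compA (compA (fmap S h)) munit_nat // -compA compA
               mmul_unitl // comp1m.
  by split=> [C x y|C] /=; rewrite !E ?bp_compDl ?bp_comp0l.
- move=> A B; have E (C : X) (h : mor (bp_prod b A B) (S C)) :
    mmul S C \circ fmap S h \circ (munit S (bp_prod b A B) \circ bp_in1 b A B)
      = h \circ bp_in1 b A B.
    by rewrite -!compA (compA (fmap S h)) munit_nat // -compA compA
               mmul_unitl // comp1m.
  by split=> [C x y|C] /=; rewrite !E ?bp_compDl ?bp_comp0l.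
Defined.

Definition kleisli_op_D (d : forall V : X, mor (S V) (S (bp_prod b V V)))
    (A B : kleisli_op) (f : @mor kleisli_op A B) :
    @mor kleisli_op (la_prod kleisli_op_cla A A) B :=
  d A \circ (f : @mor X B (S A)).

End KleisliOp.
Arguments kleisli_op {X S} _.
Arguments kleisli_op_cla {X S} _ _.
Arguments kleisli_op_D {X S} _ {b} _ {A B} _.

Section PSeries.
Variables (F : fieldType) (V : lmodType F).

(* Components are shifted by one: [t n] is the component of degree [n.+1]. *)
Definition pseries : Type := forall n : nat, coinv V n.+1.

HB.instance Definition _ := gen_eqMixin pseries.
HB.instance Definition _ := gen_choiceMixin pseries.

Lemma pseriesP (s t : pseries) : (forall n, s n = t n) <-> s = t.
Proof. by split=> [st|-> //]; apply: functional_extensionality_dep. Qed.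

Definition ps_zero : pseries := fun=> 0.
Definition ps_add (s t : pseries) : pseries := fun n => s n + t n.
Definition ps_opp (s : pseries) : pseries := fun n => - s n.
Definition ps_scale (a : F) (s : pseries) : pseries := fun n => a *: s n.

Fact ps_addA : associative ps_add.
Proof. by move=> s t u; apply/pseriesP => n; apply: addrA. Qed.
Fact ps_addC : commutative ps_add.
Proof. by move=> s t; apply/pseriesP => n; apply: addrC. Qed.
Fact ps_add0 : left_id ps_zero ps_add.
Proof. by move=> s; apply/pseriesP => n; apply: add0r. Qed.
Fact ps_addN : left_inverse ps_zero ps_opp ps_add.
Proof. by move=> s; apply/pseriesP => n; apply: addNr. Qed.

HB.instance Definition _ := GRing.isZmodule.Build pseries
  ps_addA ps_addC ps_add0 ps_addN.

Fact ps_scaleA a b s : ps_scale a (ps_scale b s) = ps_scale (a * b) s.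
Proof. by apply/pseriesP => n; apply: scalerA. Qed.
Fact ps_scale1 : left_id 1 ps_scale.
Proof. by move=> s; apply/pseriesP => n; apply: scale1r. Qed.
Fact ps_scaleDr : right_distributive ps_scale +%R.
Proof. by move=> a s t; apply/pseriesP => n; apply: scalerDr. Qed.
Fact ps_scaleDl s : {morph ps_scale^~ s : a b / a + b}.
Proof. by move=> a b; apply/pseriesP => n; apply: scalerDl. Qed.

HB.instance Definition _ := GRing.Zmodule_isLmodule.Build F pseries
  ps_scaleA ps_scale1 ps_scaleDr ps_scaleDl.

Lemma ps_linE a (s t : pseries) n : (a *: s + t) n = a *: s n + t n.
Proof. by []. Qed.

End PSeries.

Section PFunctor.
Variables (F : fieldType) (V W : lmodType F) (f : {linear V -> W}).

Definition ps_map (t : pseries V) : pseries W := fun n => coinv_map n.+1 f (t n).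

Fact ps_map_linear : linear ps_map.
Proof. by move=> a s t; apply/pseriesP => n; rewrite /ps_map !ps_linE linearP. Qed.

HB.instance Definition _ := GRing.isLinear.Build F _ _ *:%R ps_map ps_map_linear.

End PFunctor.

Section Unit.
Variables (F : fieldType) (V : lmodType F).

Definition ps_eta (v : V) : pseries V :=
  fun n => if n is 0 then mon [tuple v] else 0.

Fact ps_eta_linear : linear ps_eta.
Proof.
move=> a x y; apply/pseriesP => -[|n]; rewrite ps_linE /=; last first.
  by rewrite scaler0 addr0.
have E z : [tuple z] = tupd [tuple 0] ord0 z :> 1.-tuple V.
  by apply: eq_from_tnth => k; rewrite tnth_mktuple !ord1 eqxx.
by rewrite (E (a *: x + y)) (E x) (E y) mon_multilinear.
Qed.

HB.instance Definition _ := GRing.isLinear.Build F _ _ *:%R ps_eta ps_eta_linear.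

Fact thead_multilinear : multilinear (fun v : 1.-tuple V => thead v).
Proof. by move=> v i a x y; rewrite /thead !tnth_mktuple !ord1 eqxx. Qed.

Fact thead_symmetric : symmetric_map (fun v : 1.-tuple V => thead v).
Proof. by move=> v s; rewrite /thead tnth_mktuple !ord1. Qed.

(* The identification of the degree 1 coinvariants with [V]. *)
Definition coinv1 : {linear coinv V 1 -> V} :=
  coinv_lift thead_multilinear thead_symmetric.

Definition ps_eps (t : pseries V) : V := coinv1 (t 0%N).

Fact ps_eps_linear : linear ps_eps.
Proof. by move=> a s t; rewrite /ps_eps ps_linE linearP. Qed.

HB.instance Definition _ := GRing.isLinear.Build F _ _ *:%R ps_eps ps_eps_linear.

End Unit.

Section PairMaps.
Variables (F : fieldType) (V W : lmodType F).

Definition inl_lin (v : V) : V * W := (v, 0).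
Fact inl_lin_linear : linear inl_lin.
Proof. by move=> a x y; apply: injective_projections; rewrite //= scaler0 addr0. Qed.
HB.instance Definition _ := GRing.isLinear.Build F _ _ *:%R inl_lin inl_lin_linear.

Definition inr_lin (w : W) : V * W := (0, w).
Fact inr_lin_linear : linear inr_lin.
Proof. by move=> a x y; apply: injective_projections; rewrite //= scaler0 addr0. Qed.
HB.instance Definition _ := GRing.isLinear.Build F _ _ *:%R inr_lin inr_lin_linear.

End PairMaps.

Section Derivation.
Variables (F : fieldType) (V : lmodType F).

Section Degree.
Variable n : nat.

(* The factors of the j-th summand: [(0, v_j)] in position [j] and [(v_k, 0)]
   in the positions [k != j].  Their order is irrelevant in the coinvariants. *)
Definition dfactors (v : n.-tuple V) (j : 'I_n) : n.-tuple (V * V) :=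
  [tuple if k == j then (0, tnth v k) else (tnth v k, 0) | k < n].

Definition dmon (v : n.-tuple V) : coinv (V * V)%type n :=
  \sum_(j < n) mon (dfactors v j).

Fact dmon_multilinear : multilinear dmon.
Proof.
apply: sum_multilinear => j.
have E v : dfactors v j = [tuple (if k == j then @inr_lin F V V : {linear _ -> _}
    else @inl_lin F V V) (tnth v k) | k < n].
  by apply: eq_from_tnth => k; rewrite !tnth_mktuple; case: ifP.
by move=> v i a x y; rewrite !E mon_map_multilinear.
Qed.

Fact dmon_symmetric : symmetric_map dmon.
Proof.
move=> v s; rewrite /dmon (reindex_inj (@perm_inj _ s^-1%g)) /=.
apply: eq_bigr => j _; rewrite -(mon_symmetric (dfactors v j) s).
congr mon; apply: eq_from_tnth => k; rewrite !tnth_mktuple.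
by rewrite -(inj_eq (@perm_inj _ s) k) permKV.
Qed.

Definition coinv_d : {linear coinv V n -> coinv (V * V)%type n} :=
  coinv_lift dmon_multilinear dmon_symmetric.

Lemma coinv_dE v : coinv_d (mon v) = \sum_(j < n) mon (dfactors v j).
Proof. exact: coinv_liftE. Qed.

End Degree.

Definition ps_d (t : pseries V) : pseries (V * V)%type :=
  fun n => coinv_d n.+1 (t n).

Fact ps_d_linear : linear ps_d.
Proof. by move=> a s t; apply/pseriesP => n; rewrite /ps_d !ps_linE linearP. Qed.

HB.instance Definition _ := GRing.isLinear.Build F _ _ *:%R ps_d ps_d_linear.

End Derivation.

Section Multiplication.
Variables (F : fieldType) (V : lmodType F).

Section Degrees.
Variables k n : nat.

(* [t_1(n_1) * ... * t_k(n_k)] for [n_j = (p j).+1], as an element of the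
   coinvariants of degree [n_1 + ... + n_k]. *)
Definition comp_prod (p : {ffun 'I_k -> 'I_n}) (t : k.-tuple (pseries V)) :
    {m : nat & coinv V m} :=
  \big[@tsmul F V/@tsone F V]_(j < k) Tagged (fun m => coinv V m) (tnth t j (p j)).

(* A single summand is not invariant under permutations of the [t_j]; the sum
   over all ordered tuples [(n_1, ..., n_k)] of positive integers is. *)
Definition comp_sum (t : k.-tuple (pseries V)) : coinv V n :=
  \sum_(p : {ffun 'I_k -> 'I_n} | \sum_(j < k) (p j).+1 == n)
     tcomp n (comp_prod p t).

Lemma tsmul_big_linear (d : 'I_k -> nat) (x y z : forall j, coinv V (d j))
    (a : F) (i : 'I_k) (r : seq 'I_k) :
  uniq r ->
  (forall j, j != i -> x j = z j /\ y j = z j) ->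
  z i = a *: x i + y i ->
  let B u := \big[@tsmul F V/@tsone F V]_(j <- r) Tagged (fun m => coinv V m) (u j) in
  exists m (X Y Z : coinv V m),
    [/\ B x = Tagged (fun m => coinv V m) X, B y = Tagged (fun m => coinv V m) Y,
        B z = Tagged (fun m => coinv V m) Z &
        if i \in r then Z = a *: X + Y else X = Z /\ Y = Z].
Proof.
move=> + ne zi B; rewrite {}/B; elim: r => [_|j r IH /= /andP[jr /IH]].
  exists (size ([::] : seq V)), (mon (in_tuple [::])), (mon (in_tuple [::])),
    (mon (in_tuple [::])).
  by rewrite !big_nil.
case=> m [X [Y [Z [EX EY EZ R]]]]; rewrite !big_cons EX EY EZ.
exists (d j + m)%N, (smul (x j) X), (smul (y j) Y), (smul (z j) Z); split=> //.
rewrite in_cons; move: R; have [Eij|nij] := eqVneq i j.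
  subst j; rewrite (negPf jr) /= => -[-> ->].
  by rewrite zi /smul linearP.
have [-> ->] : x j = z j /\ y j = z j by apply: ne; rewrite eq_sym.
by case: ifP => _ => [->|[-> ->]] //; rewrite linearP.
Qed.

Fact comp_sum_multilinear : multilinear comp_sum.
Proof.
apply: sum_multilinear => p t i a x y.
have := @tsmul_big_linear (fun j => (p j).+1)
  (fun j => tnth (tupd t i x) j (p j)) (fun j => tnth (tupd t i y) j (p j))
  (fun j => tnth (tupd t i (a *: x + y)) j (p j)) a i (index_enum _)
  (index_enum_uniq _).
case=> [j ne||m [X [Y [Z [EX EY EZ]]]]].
- by rewrite !tnth_mktuple (negPf ne).
- by rewrite !tnth_mktuple eqxx.
rewrite mem_index_enum /comp_prod EX EY EZ => ->.
exact: (linearP (@cast_coinv F V m n)).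
Qed.

Fact comp_sum_symmetric : symmetric_map comp_sum.
Proof.
move=> t s; rewrite /comp_sum.
pose h (p : {ffun 'I_k -> 'I_n}) : {ffun 'I_k -> 'I_n} := [ffun j => p (s j)].
have h_inj : injective h.
  move=> p q /ffunP E; apply/ffunP => j.
  by have := E (s^-1 j)%g; rewrite !ffunE permKV.
rewrite (reindex_inj h_inj) /=; apply: eq_big => [p|p _].
  rewrite [in RHS](reindex_inj (@perm_inj _ s)) /=.
  by congr (_ == _); apply: eq_bigr => j _; rewrite ffunE.
congr tcomp; rewrite /comp_prod [in RHS](reindex_inj (@perm_inj _ s)) /=.
by apply: eq_bigr => j _; rewrite tnth_mktuple ffunE.
Qed.

Definition coinv_comp : {linear coinv (pseries V) k -> coinv V n} :=
  coinv_lift comp_sum_multilinear comp_sum_symmetric.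

Lemma coinv_compE t : coinv_comp (mon t) = comp_sum t.
Proof. exact: coinv_liftE. Qed.

End Degrees.

Definition ps_mu (s : pseries (pseries V)) : pseries V :=
  fun n => \sum_(k < n.+1) coinv_comp k.+1 n.+1 (s k).

Fact ps_mu_linear : linear ps_mu.
Proof.
move=> a s t; apply/pseriesP => n; rewrite ps_linE /ps_mu scaler_sumr -big_split.
by apply: eq_bigr => k _; rewrite ps_linE linearP.
Qed.

HB.instance Definition _ := GRing.isLinear.Build F _ _ *:%R ps_mu ps_mu_linear.

End Multiplication.

Definition VEC (F : fieldType) : category.
Proof.
apply: (@Category (lmodType F) (fun V W : lmodType F => {linear V -> W})
  (fun V : lmodType F => idfun : {linear V -> V})
  (fun (U V W : lmodType F) (g : {linear V -> W}) (f : {linear U -> V}) =>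
     g \o f : {linear U -> W})).
- by move=> U V f; apply: linear_ext.
- by move=> U V f; apply: linear_ext.
- by move=> U V W Z h g f; apply: linear_ext.
Defined.

Section VecBiproducts.
Variable F : fieldType.

Definition VEC_hom_monoids : hom_monoids (VEC F).
Proof.
apply: (@HomMonoids (VEC F)
  (fun (V W : lmodType F) (f g : {linear V -> W}) => f \+ g : {linear V -> W})
  (fun V W : lmodType F => \0 : {linear V -> W})).
- by move=> V W f g h; apply: linear_ext => x /=; rewrite addrA.
- by move=> V W f g; apply: linear_ext => x /=; rewrite addrC.
- by move=> V W f; apply: linear_ext => x /=; rewrite addr0.
Defined.

Definition VEC_biproducts : biproducts (VEC F).
Proof.
refine (@Biproducts (VEC F) VEC_hom_monoids _ _ _ _ 'rV[F]_0 _ _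
  (fun V W : lmodType F => (V * W)%type : lmodType F)
  (fun V W : lmodType F => fst : {linear (V * W)%type -> V})
  (fun V W : lmodType F => snd : {linear (V * W)%type -> W})
  (fun V W : lmodType F => @inl_lin F V W : {linear V -> (V * W)%type})
  (fun V W : lmodType F => @inr_lin F V W : {linear W -> (V * W)%type}) _ _ _ _ _).
- by move=> A B C f g x; apply: linear_ext.
- by move=> A B C f x y; apply: linear_ext => v /=; rewrite linearD.
- by move=> A B C x; apply: linear_ext.
- by move=> A B C f; apply: linear_ext => v /=; rewrite linear0.
- by move=> A f; apply: linear_ext => v; rewrite [LHS]thinmx0 [RHS]thinmx0.
- by move=> A f; apply: linear_ext => v; rewrite [v]thinmx0 !linear0.
- by move=> A B; apply: linear_ext.
- by move=> A B; apply: linear_ext.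
- by move=> A B; apply: linear_ext.
- by move=> A B; apply: linear_ext.
- move=> A B; apply: linear_ext => -[x y] /=.
  by apply: injective_projections; rewrite /= ?addr0 ?add0r.
Defined.

Definition P_functor : functor (VEC F) (VEC F).
Proof.
refine (@Functor (VEC F) (VEC F)
  (fun V : lmodType F => pseries V : lmodType F)
  (fun (V W : lmodType F) (f : {linear V -> W}) =>
     ps_map f : {linear pseries V -> pseries W}) _ _).
- move=> V; apply: linear_ext => t; apply/pseriesP => n.
  apply: (coinv_ext (f := coinv_map n.+1 idfun) (g := idfun)) => v.
  rewrite coinv_mapE; congr mon.
  by apply: eq_from_tnth => k; rewrite tnth_mktuple.
- move=> U V W g f; apply: linear_ext => t; apply/pseriesP => n.
  apply: (coinv_ext (f := coinv_map n.+1 (g \o f))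
                    (g := coinv_map n.+1 g \o coinv_map n.+1 f)) => v /=.
  rewrite !coinv_mapE; congr mon.
  by apply: eq_from_tnth => k; rewrite !tnth_mktuple.
Defined.

Definition P_data : monad_data (VEC F) :=
  @MonadData (VEC F) P_functor
    (fun V : lmodType F => @ps_mu F V : {linear pseries (pseries V) -> pseries V})
    (fun V : lmodType F => @ps_eta F V : {linear V -> pseries V}).

Definition P_d (V : VEC F) :
    @mor (VEC F) (P_data V) (P_data (bp_prod VEC_biproducts V V)) :=
  @ps_d F V : {linear pseries V -> pseries (V * V)%type}.

Definition P_eps (V : VEC F) : @mor (VEC F) (P_data V) V :=
  @ps_eps F V : {linear pseries V -> V}.

End VecBiproducts.

(* Main.v *)
From HB Require Import structures.
From mathcomp Require Import all_boot.
Require Import Defs.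
From mathcomp Require Import all_algebra.
From mathcomp Require Import boolp.

(** The statement splits into a formal part, valid for every monad on a category
    with biproducts, and a computation with power series.

    Formal part.  In the opposite of the Kleisli category all structure maps are
    pure, of the form unit after a map of the base category, so the axioms of a
    Cartesian differential category unfold to the laws of a differential combinator
    ([kleisli_D_cartesian_differential]).  A D-linear unit [e] makes
    [f |-> e \circ f] and [h |-> η \circ h] mutually inverse between D-linear
    maps and maps of the base category ([D_lin_kleisli_op]).

    Power series.  Allowing a constant term turns [pseries V] into the ideal of
    series without constant term of a commutative ring [fps V], the completed
    symmetric algebra of [V].  It is topologically generated by the variables
    [fps_var v]: a linear map compatible with the degree filtration is determined
    by its values on products of variables ([fmon_ext]).  Therefore two ring
    morphisms, or two derivations over the same ring morphism, that respect the
    filtration coincide as soon as they agree on variables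
    ([filtered_morph_ext], [filtered_deriv_ext]).

    Under this dictionary:
    - [ps_map f] is the ring morphism sending the variable of [v] to that of [f v];
    - [ps_eta v] is the variable of [v];
    - [ps_mu] is substitution, the ring morphism sending the variable of a series
      [t] to [t] itself; that the sum over compositions of [n] computes the degree
      [n] part of a product of series is the distributivity of the product over
      sums ([comp_sum_prod]);
    - [ps_d] is the derivation over [ps_map inl_lin] sending the variable of [v]
      to that of [inr_lin v].

    The monad laws and the chain rule [dc4] then compare two morphisms, or two
    derivations, and need only be read on variables, where they are immediate;
    naturality and additivity of the derivative are of the same kind.  The laws
    about second derivatives concern composites that are not derivations; they
    are checked on monomials. *)

Set Implicit Arguments.
Unset Strict Implicit.
Unset Printing Implicit Defensive.
Import GRing.Theory.

(** * The Kleisli category of a monad with a differential combinator *)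

Lemma functor_ext (C D : category) (o : C -> D)
    (m m' : forall A B, mor A B -> mor (o A) (o B)) p1 pM p1' pM' :
  (forall A B (f : mor A B), m A B f = m' A B f) ->
  @Functor C D o m p1 pM = @Functor C D o m' p1' pM'.
Proof.
move=> mm'; have E : m = m'.
  apply: functional_extensionality_dep => A.
  by apply: functional_extensionality_dep => B; apply/funext => f; apply: mm'.
by subst m'; congr Functor; apply: Prop_irrelevance.
Qed.

Section Kleisli.
Local Open Scope cat_scope.
Variables (X : category) (S : monad_data X) (b : biproducts X).
Variable d : forall V : X, mor (S V) (S (bp_prod b V V)).
Hypotheses (mS : is_monad S) (dS : is_differential_combinator b S d).

Local Notation in0 := (bp_in0 b _ _).
Local Notation in1 := (bp_in1 b _ _).
Local Notation pi0 := (bp_pi0 b _ _).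
Local Notation pi1 := (bp_pi1 b _ _).
Local Notation "'η'" := (munit S _).
Local Notation "'μ'" := (mmul S _).
Local Notation "[| f ; g |]" := (bp_copair b f g).

Lemma bp_from_prod_ext (A B C : X) (h k : mor (bp_prod b A B) C) :
  h \circ in0 = k \circ in0 -> h \circ in1 = k \circ in1 -> h = k.
Proof. by move=> e0 e1; rewrite [LHS]bp_copair_uniq e0 e1 -bp_copair_uniq. Qed.

Lemma bp_comp_copair (A B C D : X) (h : mor C D) (f : mor A C) (g : mor B C) :
  h \circ [| f ; g |] = [| h \circ f ; h \circ g |].
Proof. by rewrite /bp_copair bp_compDr !compA. Qed.

Lemma bp_map_in0 (A B A' B' : X) (f : mor A A') (g : mor B B') :
  bp_map b f g \circ in0 = in0 \circ f.
Proof.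
rewrite /bp_map /bp_pair bp_compDl -!compA bp_pi0in0 bp_pi1in0 compm1.
by rewrite !bp_comp0r hadd0.
Qed.

Lemma bp_map_in1 (A B A' B' : X) (f : mor A A') (g : mor B B') :
  bp_map b f g \circ in1 = in1 \circ g.
Proof.
rewrite /bp_map /bp_pair bp_compDl -!compA bp_pi0in1 bp_pi1in1 compm1.
by rewrite !bp_comp0r haddC hadd0.
Qed.

Lemma bp_copair_map (A B A' B' C : X) (f : mor A A') (g : mor B B')
    (h : mor A' C) (k : mor B' C) :
  [| h ; k |] \circ bp_map b f g = [| h \circ f ; k \circ g |].
Proof.
apply: bp_from_prod_ext; rewrite -compA ?bp_map_in0 ?bp_map_in1 compA.
  by rewrite !bp_copair_in0.
by rewrite !bp_copair_in1.
Qed.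

Lemma bp_copair_ins (A B A' B' : X) (f : mor A A') (g : mor B B') :
  [| in0 \circ f ; in1 \circ g |] = bp_map b f g.
Proof. by rewrite /bp_map /bp_pair /bp_copair -!compA. Qed.

Lemma bp_copair_h0 (A B C : X) (h : mor A C) :
  [| h ; hzero b B C |] = h \circ pi0.
Proof. by rewrite /bp_copair bp_comp0l hadd0. Qed.

Lemma bp_copair_0h (A B C : X) (h : mor B C) :
  [| hzero b A C ; h |] = h \circ pi1.
Proof. by rewrite /bp_copair bp_comp0l haddC hadd0. Qed.

(** The structure maps of the Kleisli category (projections, zero, lifts, flips)
    are all pure, that is of the form [η \circ h].  Substituting a pure map is
    just applying [S h], so this lemma and the next two turn each axiom about
    them into an equation between maps of [X]. *)
Lemma kleisli_unit (A B : X) (h : mor A B) :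
  μ \circ fmap S (η \circ h) = fmap S h.
Proof. by rewrite fmapM compA mmul_unitr // comp1m. Qed.

Lemma kleisli_subst_unit (A B C : X) (f : mor A (S B)) (h : mor C A) :
  μ \circ fmap S f \circ (η \circ h) = f \circ h.
Proof. by rewrite compA -(compA μ) munit_nat // compA mmul_unitl // comp1m. Qed.

Local Notation K := (kleisli_op mS).
Local Notation L := (kleisli_op_cla mS b).

Lemma fmap_unit_comp (A B C : X) (h : mor A B) (k : mor C A) :
  fmap S h \circ (η \circ k) = η \circ (h \circ k).
Proof. by rewrite compA munit_nat // compA. Qed.

Lemma bp_flip_copair (A : X) :
  bp_flip b A = [| [| in0 \circ in0 ; in1 \circ in0 |] ;
                   [| in0 \circ in1 ; in1 \circ in1 |] |].
Proof.
apply: bp_from_prod_ext; rewrite ?bp_copair_in0 ?bp_copair_in1;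
  apply: bp_from_prod_ext; rewrite ?bp_copair_in0 ?bp_copair_in1;
  rewrite /bp_flip /bp_pair !bp_compDl -!(compA (bp_in0 _ _ _))
    -!(compA (bp_in1 _ _ _)) ?bp_map_in0 ?bp_map_in1 -!compA;
  rewrite ?bp_pi0in0 ?bp_pi0in1 ?bp_pi1in0 ?bp_pi1in1 ?bp_comp0r ?compm1 ?hadd0 //;
  by rewrite haddC hadd0.
Qed.

(** Copairings of injections turn the Kleisli substitutions of the axioms into
    [S] of one of the maps of the [dc] laws; each axiom is then one law:
    the two halves of CD2 are [dc2] and [dc1], CD3 is [dc3], CD5 is [dc4] with
    naturality, CD6 is [dc5] and CD7 is [dc6].  CD1 and CD4 only use that [D] is
    composition with [d]. *)
Lemma kleisli_D_cartesian_differential :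
  is_cartesian_differential L (@kleisli_op_D X S mS b d).
Proof.
split.
- by move=> A B f g; rewrite /kleisli_op_D /= bp_compDr.
- by move=> A B; rewrite /kleisli_op_D /= bp_comp0r.
- move=> A B f; rewrite /la_nabla /= /kleisli_op_D !kleisli_unit.
  rewrite munit_nat // -bp_compDr !fmap_unit_comp -!bp_comp_copair !kleisli_unit.
  have inE (h : @mor X A (bp_prod b A A)) :
      [| in0 ; in1 \circ h |] = bp_map b (@idm X A) h.
    by rewrite -bp_copair_ins compm1.
  rewrite !inE !compA -!bp_compDl -dc2 //.
  by rewrite /bp_diag /bp_pair !compm1.
- move=> A B f; rewrite /la_in0 /kleisli_op_D /=.
  by rewrite bp_copair_h0 kleisli_unit compA dc1 // bp_comp0l.
- by move=> A; rewrite /kleisli_op_D /=; exact: dc3.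
- by move=> A B; rewrite /kleisli_op_D /= kleisli_subst_unit compA dc3.
- by move=> A B; rewrite /kleisli_op_D /= kleisli_subst_unit compA dc3.
- by move=> A B C f g; rewrite /kleisli_op_D /= bp_comp_copair.
- move=> A B C g f; rewrite /kleisli_op_D /= !kleisli_unit.
  rewrite -bp_copair_map fmapM -!compA (compA (fmap S (bp_map b f f))).
  by rewrite (dc_nat dS) !compA dc4.
- move=> A B f; rewrite /kleisli_op_D /la_lift /la_map /la_in0 /la_in1 /=.
  rewrite !kleisli_unit bp_copair_h0 bp_copair_0h !fmap_unit_comp.
  by rewrite -bp_comp_copair bp_copair_ins kleisli_unit !compA dc5.
- move=> A B f; rewrite /kleisli_op_D /la_flip /la_map /=.
  rewrite !kleisli_unit !fmap_unit_comp -!bp_comp_copair -bp_flip_copair.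
  by rewrite kleisli_unit !compA dc6.
Qed.

(** * D-linear maps *)

Variable e : forall V : X, mor (S V) V.
Hypothesis eS : is_D_linear_unit_op b S d e.
Hypothesis cdK : is_cartesian_differential L (@kleisli_op_D X S mS b d).

Lemma D_linear_pure (A B : X) (h : mor B A) :
  @D_linear K L (@kleisli_op_D X S mS b d) A B (η \circ h : @mor X _ _).
Proof.
rewrite /D_linear /kleisli_op_D /= kleisli_unit fmap_unit_comp.
by rewrite compA dc3 // compA.
Qed.

(** A D-linear map is pure: D-linearity says that [d A \circ f] is [S in1 \circ f],
    and [S pi1] undoes [S in1], while by [du2] it sends [d A] to [η \circ e A]. *)
Lemma D_linearK (A B : X) (f : mor B (S A)) :
  @D_linear K L (@kleisli_op_D X S mS b d) A B f -> η \circ (e A \circ f) = f.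
Proof.
rewrite /D_linear /kleisli_op_D /= kleisli_unit => fl.
by rewrite compA (du2 eS) -compA fl compA -fmapM bp_pi1in1 fmap1 comp1m.
Qed.

Definition D_lin_to_op : functor (D_lin_category cdK) (op_category X).
Proof.
refine (@Functor (D_lin_category cdK) (op_category X) (fun A : X => A)
  (fun (A B : X) f => e A \circ (sval f : @mor X B (S A))) _ _).
- by move=> A /=; apply: (du1 eS).
- move=> A B C [g gl] [f fl] /=.
  by rewrite -{1}(D_linearK gl) kleisli_subst_unit compA.
Defined.

Definition op_to_D_lin : functor (op_category X) (D_lin_category cdK).
Proof.
refine (@Functor (op_category X) (D_lin_category cdK) (fun A : X => A)
  (fun (A B : X) (h : @mor X B A) => exist _ _ (D_linear_pure h)) _ _).
- by move=> A /=; apply: eq_exist; apply: compm1.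
- move=> A B C g f /=; apply: eq_exist => /=.
  by rewrite kleisli_subst_unit !compA.
Defined.

Lemma D_lin_kleisli_op :
  isomorphic_categories (D_lin_category cdK) (op_category X).
Proof.
exists D_lin_to_op, op_to_D_lin; split; apply: functor_ext.
- by move=> A B [f fl]; apply: eq_exist => /=; apply: D_linearK.
- by move=> A B h /=; rewrite compA (du1 eS) comp1m.
Qed.

End Kleisli.

(** * Power series with a constant term *)

Local Open Scope ring_scope.

Section Series.
Variables (F : fieldType) (V : lmodType F).

Definition fps : Type := forall n : nat, coinv V n.

HB.instance Definition _ := gen_eqMixin fps.
HB.instance Definition _ := gen_choiceMixin fps.

Lemma fpsP (x y : fps) : (forall n, x n = y n) -> x = y.
Proof. exact: functional_extensionality_dep. Qed.

Definition fps_zero : fps := fun=> 0.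
Definition fps_add (x y : fps) : fps := fun n => x n + y n.
Definition fps_opp (x : fps) : fps := fun n => - x n.
Definition fps_scale (a : F) (x : fps) : fps := fun n => a *: x n.

Fact fps_addA : associative fps_add.
Proof. by move=> x y z; apply: fpsP => n; apply: addrA. Qed.
Fact fps_addC : commutative fps_add.
Proof. by move=> x y; apply: fpsP => n; apply: addrC. Qed.
Fact fps_add0 : left_id fps_zero fps_add.
Proof. by move=> x; apply: fpsP => n; apply: add0r. Qed.
Fact fps_addN : left_inverse fps_zero fps_opp fps_add.
Proof. by move=> x; apply: fpsP => n; apply: addNr. Qed.

HB.instance Definition _ := GRing.isZmodule.Build fps
  fps_addA fps_addC fps_add0 fps_addN.

Fact fps_scaleA a b x : fps_scale a (fps_scale b x) = fps_scale (a * b) x.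
Proof. by apply: fpsP => n; apply: scalerA. Qed.
Fact fps_scale1 : left_id 1 fps_scale.
Proof. by move=> x; apply: fpsP => n; apply: scale1r. Qed.
Fact fps_scaleDr : right_distributive fps_scale +%R.
Proof. by move=> a x y; apply: fpsP => n; apply: scalerDr. Qed.
Fact fps_scaleDl x : {morph fps_scale^~ x : a b / a + b}.
Proof. by move=> a b; apply: fpsP => n; apply: scalerDl. Qed.

HB.instance Definition _ := GRing.Zmodule_isLmodule.Build F fps
  fps_scaleA fps_scale1 fps_scaleDr fps_scaleDl.

Lemma fpsDE (x y : fps) n : (x + y) n = x n + y n. Proof. by []. Qed.
Lemma fpsZE a (x : fps) n : (a *: x) n = a *: x n. Proof. by []. Qed.
Lemma fps_sumE I (r : seq I) (P : pred I) (G : I -> fps) n :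
  (\sum_(i <- r | P i) G i) n = \sum_(i <- r | P i) G i n.
Proof. by apply: (big_morph (fun x : fps => x n)). Qed.

Lemma cast_coinv_id n (x : coinv V n) : cast_coinv n x = x.
Proof. exact: tcompE. Qed.

Lemma cast_coinv_neq m n (x : coinv V m) : m != n -> cast_coinv n x = 0.
Proof. exact: tcomp_dflt. Qed.

Definition homog n (a : coinv V n) : fps := fun m => cast_coinv m a.

Fact homog_linear n : linear (@homog n).
Proof. by move=> a x y; apply: fpsP => m; rewrite /homog linearP. Qed.

HB.instance Definition _ n := GRing.isLinear.Build F _ _ *:%R (@homog n)
  (@homog_linear n).

Definition fmon (s : seq V) : fps := homog (mon (in_tuple s)).

Lemma fmonE n (v : n.-tuple V) : homog (mon v) = fmon v.
Proof.
have := tmonE v; rewrite /tmon /fmon => E.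
by apply: fpsP => m; rewrite /homog /cast_coinv E.
Qed.

End Series.
Arguments fmon {F V} s.
Arguments homog {F V n} a.

Section Filtered.
Variable F : fieldType.
Implicit Types U V W : lmodType F.

(** Linearity together with compatibility with the filtration by order, that is
    continuity for the topology of power series with a uniform modulus: the part
    of degree [n] of [f x] depends only on the parts of degree at most [n] of
    [x].  It is a property of bare functions, so that composites and partial
    products can be treated without bundling them; [linear_of] bundles them when
    the theory of linear maps is wanted. *)
Definition filtered V W (f : fps V -> fps W) : Prop :=
  linear f /\ forall n x, (forall k, (k <= n)%N -> x k = 0) -> f x n = 0.

Lemma filtered_id V : filtered (@id (fps V)).
Proof. by split=> [a x y|n x x0] //; apply: x0. Qed.

Lemma filtered_comp U V W (g : fps V -> fps W) (f : fps U -> fps V) :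
  filtered g -> filtered f -> filtered (g \o f).
Proof.
move=> [gl gc] [fl fc]; split=> [a x y|n x x0] /=; first by rewrite fl gl.
by apply: gc => k kn; apply: fc => j jk; apply: x0; apply: leq_trans kn.
Qed.

Lemma filtered_add V W (f g : fps V -> fps W) :
  filtered f -> filtered g -> filtered (fun x => f x + g x).
Proof.
move=> [fl fc] [gl gc]; split=> [a x y|n x x0]; last first.
  by rewrite fpsDE fc // gc // addr0.
by rewrite fl gl scalerDr addrACA.
Qed.

Lemma filtered_degreewise V W (f : forall n, {linear coinv V n -> coinv W n}) :
  filtered (fun (x : fps V) n => f n (x n) : coinv W n).
Proof.
split=> [a x y|n x x0]; last by rewrite x0 ?linear0.
by apply: fpsP => n; rewrite fpsDE fpsZE linearP.
Qed.

Definition linear_of (U W : lmodType F) (f : U -> W) (fl : linear f) :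
    {linear U -> W} :=
  HB.pack f (GRing.isLinear.Build F U W *:%R f fl).

(** In degree [n], a filtered map does not see the difference between a series
    and the finite sum of its homogeneous parts of degree at most [n]. *)
Lemma homog_ext V W (f g : fps V -> fps W) :
  filtered f -> filtered g ->
  (forall n (a : coinv V n), f (homog a) = g (homog a)) -> f =1 g.
Proof.
suff trunc (h : fps V -> fps W) x n :
    filtered h -> h x n = \sum_(k < n.+1) h (homog (x k)) n.
  move=> fF gF fg x; apply: fpsP => n; rewrite !trunc //.
  by apply: eq_bigr => k _; rewrite fg.
move=> [hl hc]; pose H := linear_of hl.
rewrite -(fps_sumE _ _ (fun k : 'I_n.+1 => h (homog (x k)))) -(linear_sum H).
have -> : h x =
    H (x - \sum_(k < n.+1) homog (x k)) + H (\sum_(k < n.+1) homog (x k)).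
  by rewrite -linearD subrK.
rewrite fpsDE [X in X + _](_ : _ = 0) ?add0r //; apply: hc => m mn.
apply/eqP; rewrite subr_eq0 fps_sumE.
rewrite (bigD1 (Ordinal (mn : m < n.+1)%N)) //= /homog cast_coinv_id.
rewrite big1 ?addr0 // => k km.
by rewrite cast_coinv_neq.
Qed.

(** Monomials span the homogeneous parts. *)
Lemma fmon_ext V W (f g : fps V -> fps W) :
  filtered f -> filtered g -> (forall s, f (fmon s) = g (fmon s)) -> f =1 g.
Proof.
move=> fF gF fg; apply: homog_ext => // n.
apply: (coinv_ext (f := linear_of fF.1 \o homog) (g := linear_of gF.1 \o homog)).
by move=> v /=; rewrite fmonE fg.
Qed.

End Filtered.

(** * The ring of power series *)

Section Product.
Variables (F : fieldType) (V : lmodType F).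
Local Notation A := (fps V).

Definition fps_mul (x y : A) : A :=
  fun n => \sum_(i < n.+1) cast_coinv n (smul (x i) (y (n - i)%N)).

Definition fps_one : A := fmon [::].

Fact smulDl m n (a : F) (x x' : coinv V m) (y : coinv V n) :
  smul (a *: x + x') y = a *: smul x y + smul x' y.
Proof. exact: linearP. Qed.

Fact smul0l m n (y : coinv V n) : smul (0 : coinv V m) y = 0.
Proof. exact: linear0. Qed.

Lemma filtered_mull (y : A) : filtered (fps_mul^~ y).
Proof.
split=> [a x x'|n x x0]; last first.
  by apply: big1 => i _; rewrite x0 ?smul0l ?linear0 // -ltnS.
apply: fpsP => n; rewrite fpsDE fpsZE scaler_sumr -big_split.
apply: eq_bigr => i _.
by rewrite fpsDE fpsZE smulDl linearP.
Qed.

Lemma filtered_mulr (x : A) : filtered (fps_mul x).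
Proof.
split=> [a y y'|n y y0]; last first.
  by apply: big1 => i _; rewrite y0 ?linear0 // leq_subr.
apply: fpsP => n; rewrite fpsDE fpsZE scaler_sumr -big_split.
apply: eq_bigr => i _.
by rewrite fpsDE fpsZE !linearP.
Qed.

Lemma homogM m n (a : coinv V m) (b : coinv V n) :
  fps_mul (homog a) (homog b) = homog (smul a b).
Proof.
apply: fpsP => N; rewrite /fps_mul /homog.
have [mN|Nm] := leqP m N; last first.
  rewrite [RHS]cast_coinv_neq ?gtn_eqF ?ltn_addr //.
  apply: big1 => i _; rewrite (@cast_coinv_neq _ _ m i) ?smul0l ?linear0 //.
  by rewrite gtn_eqF // (leq_trans (ltn_ord i)).
rewrite (bigD1 (Ordinal (mN : m < N.+1)%N)) //= [X in _ + X]big1 ?addr0; last first.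
  move=> i im; rewrite (@cast_coinv_neq _ _ m i) ?smul0l ?linear0 //.
  by rewrite eq_sym.
rewrite cast_coinv_id; have [nE|nE] := eqVneq n (N - m)%N.
  by subst n; rewrite cast_coinv_id.
rewrite (cast_coinv_neq _ nE) linear0 linear0 cast_coinv_neq //.
by apply: contra_neq nE => <-; rewrite addKn.
Qed.

Lemma fps_mul_fmon s t : fps_mul (fmon s) (fmon t) = fmon (s ++ t) :> A.
Proof. by rewrite homogM smul_mon fmonE. Qed.

(** The product is filtered in each argument, so the ring laws need only be
    checked on monomials, where they are facts about concatenated sequences. *)
Fact fps_mulA : associative fps_mul.
Proof.
move=> x y z; move: x; apply: fmon_ext => [||s].
- exact: filtered_mull.
- exact: filtered_comp (filtered_mull z) (filtered_mull y).
move: y; apply: fmon_ext => [||t].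
- exact: filtered_comp (filtered_mulr _) (filtered_mull _).
- exact: filtered_comp (filtered_mull _) (filtered_mulr _).
move: z; apply: fmon_ext => [||u].
- exact: filtered_comp (filtered_mulr _) (filtered_mulr _).
- exact: filtered_mulr.
by rewrite !fps_mul_fmon catA.
Qed.

Lemma fmon_perm s t : perm_eq s t -> fmon s = fmon t :> A.
Proof.
move=> st; apply: fpsP => n.
by rewrite /fmon /homog /cast_coinv -!/(tmon _) (tmon_perm st).
Qed.

Fact fps_mulC : commutative fps_mul.
Proof.
move=> x y; move: x; apply: fmon_ext => [||s].
- exact: filtered_mull.
- exact: filtered_mulr.
move: y; apply: fmon_ext => [||t].
- exact: filtered_mulr.
- exact: filtered_mull.
by rewrite !fps_mul_fmon; apply: fmon_perm; rewrite perm_catC.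
Qed.

Fact fps_mul1 : left_id fps_one fps_mul.
Proof.
apply: (fmon_ext (filtered_mulr _) (@filtered_id _ V)) => s.
exact: fps_mul_fmon.
Qed.

Fact fps_mulDl : left_distributive fps_mul +%R.
Proof. by move=> x y z; have := (filtered_mull z).1 1 x y; rewrite !scale1r. Qed.

HB.instance Definition _ := GRing.Zmodule_isComPzRing.Build A
  fps_mulA fps_mulC fps_mul1 fps_mulDl.

Lemma fmon_cat s t : fmon (s ++ t) = fmon s * fmon t :> A.
Proof. by rewrite -fps_mul_fmon. Qed.

Definition fps_var (v : V) : A := fmon [:: v].

Lemma fmon_cons v s : fmon (v :: s) = fps_var v * fmon s.
Proof. by rewrite -fmon_cat. Qed.

End Product.

(** * Morphisms and derivations *)

Section Morphisms.
Variable F : fieldType.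
Implicit Types U V W : lmodType F.

Definition filtered_morph V W (f : fps V -> fps W) : Prop :=
  [/\ filtered f, f 1 = 1 & {morph f : x y / x * y}].

Lemma filtered_morph_id V : filtered_morph (@id (fps V)).
Proof. by split=> //; apply: filtered_id. Qed.

Lemma filtered_morph_comp U V W (g : fps V -> fps W) (f : fps U -> fps V) :
  filtered_morph g -> filtered_morph f -> filtered_morph (g \o f).
Proof.
move=> [gF g1 gM] [fF f1 fM]; split; first exact: filtered_comp.
  by rewrite /= f1.
by move=> x y /=; rewrite fM gM.
Qed.

Lemma filtered_morphI V W (f : fps V -> fps W) :
  filtered f -> f 1 = 1 ->
  (forall s t, f (fmon (s ++ t)) = f (fmon s) * f (fmon t)) ->
  filtered_morph f.
Proof.
move=> fF f1 fM; split=> // x y; move: x; apply: fmon_ext => [||s].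
- exact: filtered_comp fF (filtered_mull _).
- exact: filtered_comp (filtered_mull _) fF.
move: y; apply: fmon_ext => [||t].
- exact: filtered_comp fF (filtered_mulr _).
- exact: filtered_comp (filtered_mulr _) fF.
by rewrite -fmon_cat.
Qed.

(** A monomial is a product of variables. *)
Lemma filtered_morph_ext V W (f g : fps V -> fps W) :
  filtered_morph f -> filtered_morph g ->
  (forall v, f (fps_var v) = g (fps_var v)) -> f =1 g.
Proof.
move=> [fF f1 fM] [gF g1 gM] fg; apply: fmon_ext => //.
by elim=> [|v s IH]; rewrite ?f1 ?g1 // fmon_cons fM gM IH fg.
Qed.

(** Derivations into [fps W] seen as a module over [fps V] through [h]; [h] is the
    part of degree 0 of [h + d] as a map to dual numbers, which explains why a
    derivation is determined by [h] and by its values on variables. *)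
Definition filtered_deriv V W (h d : fps V -> fps W) : Prop :=
  filtered d /\ forall x y, d (x * y) = d x * h y + h x * d y.

(** The two base morphisms [h] and [h'] are usually composites that agree without
    being syntactically equal; their agreement, too, is only asked on variables. *)
Lemma filtered_deriv_ext V W (h d h' e : fps V -> fps W) :
  filtered_morph h -> filtered_morph h' ->
  filtered_deriv h d -> filtered_deriv h' e ->
  (forall v, h (fps_var v) = h' (fps_var v)) ->
  (forall v, d (fps_var v) = e (fps_var v)) -> d =1 e.
Proof.
move=> hM h'M [dF dM] [eF eM] hh' de; have hE := filtered_morph_ext hM h'M hh'.
have deriv1 k f : filtered_morph k -> filtered_deriv k f -> f 1 = 0.
  move=> [_ k1 _] [_ fM]; have := fM 1 1; rewrite mulr1 k1 mulr1 mul1r => E.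
  by apply: (addrI (f 1)); rewrite -E addr0.
apply: fmon_ext => //; elim=> [|v s IH]; last by rewrite fmon_cons dM eM IH de !hE.
by rewrite (deriv1 _ _ h d) // (deriv1 _ _ h' e).
Qed.

Lemma filtered_deriv_eq V W (h h' d : fps V -> fps W) :
  h =1 h' -> filtered_deriv h d -> filtered_deriv h' d.
Proof. by move=> hh' [dF dM]; split=> // x y; rewrite dM !hh'. Qed.

Lemma filtered_deriv_add V W (h d e : fps V -> fps W) :
  filtered_deriv h d -> filtered_deriv h e ->
  filtered_deriv h (fun x => d x + e x).
Proof.
move=> [dF dM] [eF eM]; split=> [|x y]; first exact: filtered_add.
by rewrite dM eM mulrDl mulrDr addrACA.
Qed.

Lemma filtered_deriv_compl U V W (g : fps V -> fps W) (h d : fps U -> fps V) :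
  filtered_morph g -> filtered_deriv h d -> filtered_deriv (g \o h) (g \o d).
Proof.
move=> [gF _ gM] [dF dM]; split=> [|x y /=]; first exact: filtered_comp.
by rewrite dM -!gM -[g (_ + _)]/(linear_of gF.1 _) linearD.
Qed.

Lemma filtered_deriv_compr U V W (h d : fps V -> fps W) (g : fps U -> fps V) :
  filtered_morph g -> filtered_deriv h d -> filtered_deriv (h \o g) (d \o g).
Proof.
move=> [gF _ gM] [dF dM]; split=> [|x y /=]; first exact: filtered_comp.
by rewrite gM dM.
Qed.

End Morphisms.

(** * Functoriality and derivative as maps of power series *)

Section DegreewiseMaps.
Variable F : fieldType.

Lemma degreewise_homog (V W : lmodType F)
    (g : forall n, {linear coinv V n -> coinv W n}) n (a : coinv V n) :
  (fun m => g m (homog a m)) = homog (g n a) :> fps W.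
Proof.
apply: fpsP => m; rewrite /homog; have [E|nm] := eqVneq n m.
  by subst m; rewrite !cast_coinv_id.
by rewrite !cast_coinv_neq // linear0.
Qed.

Section Map.
Variables (V W : lmodType F) (f : {linear V -> W}).

Definition fps_map (x : fps V) : fps W := fun n => coinv_map n f (x n).

Lemma filtered_map : filtered fps_map.
Proof. exact: (filtered_degreewise (fun n => coinv_map n f)). Qed.

Lemma fps_map_fmon s : fps_map (fmon s) = fmon (map f s).
Proof.
rewrite /fps_map (degreewise_homog (fun n => coinv_map n f)) coinv_mapE fmonE.
congr fmon; rewrite (_ : [tuple _ | _ < _] = map_tuple f (in_tuple s)) //.
by apply: eq_from_tnth => k; rewrite tnth_mktuple tnth_map.
Qed.

Lemma fps_map_morph : filtered_morph fps_map.
Proof.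
apply: filtered_morphI => [||s t]; first exact: filtered_map.
  exact: fps_map_fmon [::].
by rewrite !fps_map_fmon map_cat fmon_cat.
Qed.

Lemma fps_map_var v : fps_map (fps_var v) = fps_var (f v).
Proof. exact: fps_map_fmon. Qed.

End Map.

Section Derivative.
Variable V : lmodType F.

Definition fps_d (x : fps V) : fps (V * V)%type := fun n => coinv_d V n (x n).

Lemma filtered_d : filtered fps_d.
Proof. exact: (filtered_degreewise (coinv_d V)). Qed.

Lemma fps_d_fmon n (v : n.-tuple V) :
  fps_d (fmon v) = \sum_(j < n) fmon (dfactors v j).
Proof.
rewrite -fmonE /fps_d (degreewise_homog (coinv_d V)) coinv_dE linear_sum.
by apply: eq_bigr => j _; apply: fmonE.
Qed.

Lemma fps_d_var v : fps_d (fps_var v) = fps_var (inr_lin V v).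
Proof.
rewrite /fps_var (fps_d_fmon [tuple v]) big_ord1; congr fmon.
rewrite (_ : dfactors _ _ = [tuple (0, v)]) //.
by apply: eq_from_tnth => k; rewrite tnth_mktuple !ord1 eqxx.
Qed.

(** The Leibniz rule when the first factor is a variable: among the positions of
    the differentiated entry of [v :: s], either it is the head or it lies in [s]. *)
Lemma fps_d_varM v x :
  fps_d (fps_var v * x)
    = fps_d (fps_var v) * fps_map (@inl_lin F V V) x
      + fps_map (@inl_lin F V V) (fps_var v) * fps_d x.
Proof.
move: x; apply: fmon_ext => [||s].
- exact: filtered_comp filtered_d (filtered_mulr _).
- apply: filtered_add.
    exact: filtered_comp (filtered_mulr _) (filtered_map _).
  exact: filtered_comp (filtered_mulr _) filtered_d.
rewrite fps_d_var fps_map_var fps_map_fmon -!fmon_cons.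
rewrite (fps_d_fmon (in_tuple s)) (fps_d_fmon [tuple of v :: in_tuple s]).
rewrite big_ord_recl mulr_sumr; congr (fmon _ + _).
  rewrite (_ : dfactors _ _ =
             [tuple of inr_lin V v :: map_tuple (@inl_lin F V V) (in_tuple s)]) //.
  apply: eq_from_tnth => k; rewrite tnth_mktuple.
  by case: (unliftP ord0 k) => [i ->|->]; rewrite ?eqxx ?tnth0 ?tnthS ?tnth_map.
apply: eq_bigr => j _; rewrite -fmon_cons; congr fmon.
rewrite (_ : dfactors _ _ =
           [tuple of inl_lin V v :: dfactors (in_tuple s) j]) //.
apply: eq_from_tnth => k; rewrite tnth_mktuple.
case: (unliftP ord0 k) => [i ->|->]; rewrite ?tnth0 ?tnthS //.
by rewrite tnth_mktuple (inj_eq lift_inj).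
Qed.

(** The general Leibniz rule follows from the previous one, pulling the variables
    of a monomial out of the first factor one at a time. *)
Lemma fps_d_deriv : filtered_deriv (fps_map (@inl_lin F V V)) fps_d.
Proof.
have [_ map1 mapM] := fps_map_morph (@inl_lin F V V).
have d1 : fps_d 1 = 0 by rewrite (fps_d_fmon [tuple]) big_ord0.
split=> [|x y]; first exact: filtered_d.
move: x; apply: fmon_ext => [||s].
- exact: filtered_comp filtered_d (filtered_mull _).
- apply: filtered_add; first exact: filtered_comp (filtered_mull _) filtered_d.
  exact: filtered_comp (filtered_mull _) (filtered_map _).
elim: s => [|v s IH]; first by rewrite mul1r d1 map1 mul0r mul1r add0r.
rewrite fmon_cons -mulrA !fps_d_varM IH !mapM.
by rewrite mulrDr mulrDl !mulrA addrA.
Qed.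

End Derivative.
End DegreewiseMaps.

(** * Substitution *)

Section Substitution.
Variables (F : fieldType) (V : lmodType F).

(** The shift of degrees undoes the convention that [t n] is the part of degree
    [n.+1] of [t]. *)
Definition fps_of (t : pseries V) : fps V :=
  fun n => if n is m.+1 then t m else 0.

Lemma fps_of_inj : injective fps_of.
Proof.
move=> s t st; apply/pseriesP => n.
exact: (congr1 (fun x : fps V => x n.+1) st).
Qed.

Lemma fps_prod_congr I (r : seq I) (x y : I -> fps V) n :
  (forall i k, (k <= n)%N -> x i k = y i k) ->
  (\prod_(i <- r) x i) n = (\prod_(i <- r) y i) n.
Proof.
move=> xy; suff : forall k, (k <= n)%N ->
    (\prod_(i <- r) x i) k = (\prod_(i <- r) y i) k by apply.
elim/big_rec2: _ => // i p q _ pq k kn.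
rewrite /GRing.mul /= /fps_mul; apply: eq_bigr => j _.
by rewrite xy ?pq ?(leq_trans (leq_subr _ _)) // (leq_trans _ kn) // -ltnS.
Qed.

Lemma homog_comp_prod k n (p : {ffun 'I_k -> 'I_n}) (t : k.-tuple (pseries V)) :
  \prod_(j < k) homog (tnth t j (p j)) = homog (tagged (comp_prod p t)) :> fps V.
Proof.
rewrite /comp_prod.
apply: (big_rec2 (fun x (u : {m : nat & coinv V m}) => x = homog (tagged u))) => //.
by move=> i x u _ ->; rewrite -homogM.
Qed.

Lemma tag_comp_prod k n (p : {ffun 'I_k -> 'I_n}) (t : k.-tuple (pseries V)) :
  tag (comp_prod p t) = (\sum_(j < k) (p j).+1)%N.
Proof.
rewrite /comp_prod.
by apply: (big_morph (fun u : {m : nat & coinv V m} => tag u)).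
Qed.

(** Up to degree [n] each factor is the sum of its homogeneous parts; expanding the
    product of these sums by distributivity gives one term for each choice [p] of
    degrees, and the degree [n] part selects the choices of total degree [n]. *)
Lemma comp_sum_prod k n (t : k.-tuple (pseries V)) :
  comp_sum n t = (\prod_(j < k) fps_of (tnth t j)) n.
Proof.
rewrite (@fps_prod_congr _ _ _ (fun j => \sum_(d < n) homog (tnth t j d)));
    last first.
  move=> j [|m] mn; rewrite fps_sumE.
    by rewrite big1 // => d _; apply: cast_coinv_neq.
  rewrite (bigD1 (Ordinal mn)) //= /homog cast_coinv_id big1 ?addr0 // => d dm.
  by rewrite cast_coinv_neq.
rewrite bigA_distr_bigA fps_sumE /comp_sum big_mkcond; apply: eq_bigr => p _.
rewrite homog_comp_prod /homog /cast_coinv; case: ifPn => [_|pn].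
  by case: comp_prod.
by rewrite tcomp_dflt // tag_comp_prod.
Qed.

(** A product of [k] series without constant term has order at least [k]; this is
    why the sum defining a substitution is finite in each degree. *)
Lemma comp_sum_small k n (t : k.-tuple (pseries V)) :
  (n < k)%N -> comp_sum n t = 0.
Proof.
move=> nk; rewrite /comp_sum big_pred0 // => p; apply: gtn_eqF.
apply: (leq_trans nk); rewrite -[X in (X <= _)%N]card_ord -sum1_card.
exact: leq_sum.
Qed.

Definition fps_subst (x : fps (pseries V)) : fps V :=
  fun n => \sum_(k < n.+1) coinv_comp V k n (x k).

Lemma filtered_subst : filtered fps_subst.
Proof.
split=> [a x y|n x x0]; last first.
  by apply: big1 => k _; rewrite x0 ?linear0 // -ltnS.
apply: fpsP => n; rewrite fpsDE fpsZE scaler_sumr -big_split.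
apply: eq_bigr => k _.
by rewrite fpsDE fpsZE linearP.
Qed.

Lemma fps_subst_fmon s : fps_subst (fmon s) = \prod_(t <- s) fps_of t.
Proof.
apply: fpsP => n; rewrite big_tnth -comp_sum_prod /fps_subst /fmon /homog.
have [sn|ns] := leqP (size s) n; last first.
  rewrite comp_sum_small // big1 // => k _.
  by rewrite cast_coinv_neq ?linear0 // gtn_eqF // (leq_trans (ltn_ord k)).
rewrite (bigD1 (Ordinal (sn : size s < n.+1)%N)) //= cast_coinv_id coinv_compE.
rewrite big1 ?addr0 // => k ks.
by rewrite cast_coinv_neq ?linear0 // eq_sym.
Qed.

(** Substitution sends a monomial in the variables [t] to the product of the series
    [t], hence concatenation of monomials to products. *)
Lemma fps_subst_morph : filtered_morph fps_subst.
Proof.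
apply: filtered_morphI => [||s t]; first exact: filtered_subst.
  by rewrite (fps_subst_fmon [::]) big_nil.
by rewrite !fps_subst_fmon big_cat.
Qed.

Lemma fps_subst_var t : fps_subst (fps_var t) = fps_of t.
Proof. by rewrite fps_subst_fmon big_seq1. Qed.

End Substitution.

(** * The laws of the power series monad *)

Section Reduced.
Variables (F : fieldType).
Implicit Types U V W : lmodType F.

Lemma fps_of_eta V (v : V) : fps_of (ps_eta v) = fps_var v.
Proof.
apply: fpsP => -[|[|n]]; rewrite /= /fps_var /fmon /homog.
- by rewrite cast_coinv_neq.
- by rewrite (_ : in_tuple [:: v] = [tuple v]) ?cast_coinv_id //; apply: val_inj.
- by rewrite cast_coinv_neq.
Qed.

Lemma fps_of_map V W (f : {linear V -> W}) t :
  fps_of (ps_map f t) = fps_map f (fps_of t).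
Proof. by apply: fpsP => -[|n] //; rewrite /fps_map /= linear0. Qed.

Lemma fps_of_d V (t : pseries V) : fps_of (ps_d t) = fps_d (fps_of t).
Proof. by apply: fpsP => -[|n] //; rewrite /fps_d /= linear0. Qed.

Lemma fps_of_mu V (s : pseries (pseries V)) :
  fps_of (ps_mu s) = fps_subst (fps_of s).
Proof.
apply: fpsP => -[|n]; rewrite /fps_subst big_ord_recl linear0 ?big_ord0 ?addr0 //.
by rewrite add0r.
Qed.

Lemma fps_var_linear V : linear (@fps_var F V).
Proof.
move=> a u v; rewrite -!fps_of_eta; apply: fpsP => -[|n]; rewrite fpsDE fpsZE /=.
  by rewrite scaler0 addr0.
by rewrite linearP.
Qed.

Lemma ps_eta_nat V W (f : {linear V -> W}) v :
  ps_map f (ps_eta v) = ps_eta (f v).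
Proof. by apply: fps_of_inj; rewrite fps_of_map !fps_of_eta fps_map_var. Qed.

(** A pattern that recurs below: transport the equation to [fps] along the
    injection [fps_of], recognise both sides as morphisms or derivations, and
    compare them on variables. *)
Lemma ps_mu_nat V W (f : {linear V -> W}) s :
  ps_map f (ps_mu s) = ps_mu (ps_map (ps_map f) s).
Proof.
apply: fps_of_inj; rewrite fps_of_map !fps_of_mu fps_of_map.
move: (fps_of s); apply: (@filtered_morph_ext _ _ _ (fps_map f \o @fps_subst F V)
  (@fps_subst F W \o fps_map (ps_map f))) => [||t].
- exact: filtered_morph_comp (fps_map_morph f) (fps_subst_morph V).
- exact: filtered_morph_comp (fps_subst_morph W) (fps_map_morph _).
by rewrite /= fps_map_var !fps_subst_var fps_of_map.
Qed.

Lemma ps_mu_etal V (t : pseries V) : ps_mu (ps_eta t) = t.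
Proof. by apply: fps_of_inj; rewrite fps_of_mu fps_of_eta fps_subst_var. Qed.

Lemma ps_mu_etar V (t : pseries V) : ps_mu (ps_map (@ps_eta F V) t) = t.
Proof.
apply: fps_of_inj; rewrite fps_of_mu fps_of_map.
move: (fps_of t); apply: (@filtered_morph_ext _ _ _
  (@fps_subst F V \o fps_map (@ps_eta F V)) id) => [||v].
- exact: filtered_morph_comp (fps_subst_morph V) (fps_map_morph _).
- exact: filtered_morph_id.
by rewrite /= fps_map_var fps_subst_var fps_of_eta.
Qed.

Lemma ps_muA V (s : pseries (pseries (pseries V))) :
  ps_mu (ps_mu s) = ps_mu (ps_map (@ps_mu F V) s).
Proof.
apply: fps_of_inj; rewrite !fps_of_mu fps_of_map.
move: (fps_of s); apply: (@filtered_morph_ext _ _ _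
  (@fps_subst F V \o @fps_subst F (pseries V))
  (@fps_subst F V \o fps_map (@ps_mu F V))) => [||t].
- exact: filtered_morph_comp (fps_subst_morph _) (fps_subst_morph _).
- exact: filtered_morph_comp (fps_subst_morph _) (fps_map_morph _).
by rewrite /= fps_map_var !fps_subst_var fps_of_mu.
Qed.

Lemma ps_d_nat V W (f : {linear V -> W})
    (g : {linear (V * V)%type -> (W * W)%type}) t :
  (forall v, g (inl_lin V v) = inl_lin W (f v)) ->
  (forall v, g (inr_lin V v) = inr_lin W (f v)) ->
  ps_map g (ps_d t) = ps_d (ps_map f t).
Proof.
move=> gl gr; apply: fps_of_inj; rewrite fps_of_map !fps_of_d fps_of_map.
have := filtered_deriv_compl (fps_map_morph g) (fps_d_deriv V).
have := filtered_deriv_compr (fps_map_morph f) (fps_d_deriv W).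
move=> df dg; move: (fps_of t); apply: filtered_deriv_ext dg df _ _ => [||v|v] /=.
- exact: filtered_morph_comp (fps_map_morph _) (fps_map_morph _).
- exact: filtered_morph_comp (fps_map_morph _) (fps_map_morph _).
- by rewrite !fps_map_var gl.
- by rewrite fps_map_var !fps_d_var fps_map_var gr.
Qed.


(** The derivative is linear in its second block of variables: both sides are
    derivations over the morphism induced by [g] on the first block, so they can
    be compared on variables, where only the value of [g] on the second block
    matters. *)
Lemma ps_d_additive V W (g g1 g2 : {linear (V * V)%type -> W}) t :
  (forall v, g1 (inl_lin V v) = g (inl_lin V v)) ->
  (forall v, g2 (inl_lin V v) = g (inl_lin V v)) ->
  (forall v, g (inr_lin V v) = g1 (inr_lin V v) + g2 (inr_lin V v)) ->
  ps_map g (ps_d t) = ps_map g1 (ps_d t) + ps_map g2 (ps_d t).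
Proof.
move=> g1l g2l gr; apply: fps_of_inj.
have fps_ofD (x y : pseries W) : fps_of (x + y) = fps_of x + fps_of y.
  by apply: fpsP => -[|n] //; rewrite fpsDE /= addr0.
rewrite fps_ofD !fps_of_map !fps_of_d; move: (fps_of t).
pose h (g' : {linear (V * V)%type -> W}) := fps_map g' \o fps_map (@inl_lin F V V).
have hM g' : filtered_morph (h g').
  exact: filtered_morph_comp (fps_map_morph _) (fps_map_morph _).
have dg g' : filtered_deriv (h g') (fps_map g' \o @fps_d F V).
  exact: filtered_deriv_compl (fps_map_morph g') (fps_d_deriv V).
have hE (g' : {linear (V * V)%type -> W}) :
    (forall v, g' (inl_lin V v) = g (inl_lin V v)) -> h g' =1 h g.
  move=> g'l; apply: filtered_morph_ext => // v.
  by rewrite /h /= !fps_map_var g'l.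
have d1 := filtered_deriv_eq (hE g1 g1l) (dg g1).
have d2 := filtered_deriv_eq (hE g2 g2l) (dg g2).
apply: filtered_deriv_ext (hM g) (hM g) (dg g) (filtered_deriv_add d1 d2) _ _
  => // v /=.
rewrite !fps_d_var !fps_map_var gr.
have := fps_var_linear 1 (g1 (inr_lin V v)) (g2 (inr_lin V v)).
by rewrite !scale1r.
Qed.

(** Additivity with [g = g1 = g2] says that the left-hand side is twice itself. *)
Lemma ps_d_zero V W (g : {linear (V * V)%type -> W}) t :
  (forall v, g (inr_lin V v) = 0) -> ps_map g (ps_d t) = 0.
Proof.
move=> gr; have := @ps_d_additive V W g g g t => E.
by apply: (addrI (ps_map g (ps_d t))); rewrite -E ?addr0 // => v; rewrite gr addr0.
Qed.

Lemma ps_d_eta V (v : V) : ps_d (ps_eta v) = ps_eta (inr_lin V v).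
Proof. by apply: fps_of_inj; rewrite fps_of_d !fps_of_eta fps_d_var. Qed.

(** The chain rule: both sides are derivations over the morphism substituting
    [t (x, 0)] for the variable of [t], and both send that variable to the
    derivative of [t]. *)
Lemma ps_d_mu V
    (h : {linear (pseries V * pseries V)%type -> pseries (V * V)%type}) s :
  (forall t, h (inl_lin _ t) = ps_map (@inl_lin F V V) t) ->
  (forall t, h (inr_lin _ t) = ps_d t) ->
  ps_d (ps_mu s) = ps_mu (ps_map h (ps_d s)).
Proof.
move=> hl hr; apply: fps_of_inj.
rewrite fps_of_d !fps_of_mu fps_of_map fps_of_d; move: (fps_of s).
have hM := filtered_morph_comp (fps_subst_morph (V * V)%type) (fps_map_morph h).
have dl := filtered_deriv_compr (fps_subst_morph V) (fps_d_deriv V).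
have dr := filtered_deriv_compl hM (fps_d_deriv (pseries V)).
apply: filtered_deriv_ext _ _ dl dr _ _ => [||t|t] /=.
- exact: filtered_morph_comp (fps_map_morph _) (fps_subst_morph _).
- exact: filtered_morph_comp hM (fps_map_morph _).
- by rewrite !fps_map_var !fps_subst_var hl fps_of_map.
- by rewrite fps_d_var !fps_map_var !fps_subst_var hr fps_of_d.
Qed.

Lemma mon_zero V n (v : n.-tuple V) i : tnth v i = 0 -> mon v = 0.
Proof.
(* Multilinearity at the entry i, with 0 written as (-1) *: 0 + 0. *)
move=> v0; have -> : v = tupd v i ((-1) *: 0 + 0).
  apply: eq_from_tnth => k; rewrite tnth_mktuple scaler0 addr0.
  by case: eqP => // ->.
by rewrite mon_multilinear scaleN1r addNr.
Qed.

Lemma fps_dd_fmon V n (v : n.-tuple V) :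
  fps_d (fps_d (fmon v)) = \sum_(j < n) \sum_(k < n) fmon (dfactors (dfactors v j) k).
Proof.
rewrite fps_d_fmon -[LHS]/(linear_of (filtered_d _).1 _) linear_sum.
by apply: eq_bigr => j _; apply: fps_d_fmon.
Qed.

Lemma fps_map_sum V W (g : {linear V -> W}) I (r : seq I) (x : I -> fps V) :
  fps_map g (\sum_(i <- r) x i) = \sum_(i <- r) fps_map g (x i).
Proof. by rewrite -[LHS]/(linear_of (filtered_map g).1 _) linear_sum. Qed.

Lemma fps_map_dd V W (g : {linear ((V * V) * (V * V))%type -> W})
    n (v : n.-tuple V) :
  fps_map g (fps_d (fps_d (fmon v)))
    = \sum_(j < n) \sum_(k < n) fmon (map_tuple g (dfactors (dfactors v j) k)).
Proof.
rewrite fps_dd_fmon fps_map_sum; apply: eq_bigr => j _.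
by rewrite fps_map_sum; apply: eq_bigr => k _; apply: fps_map_fmon.
Qed.

(** In the sum over the positions [j], [k] differentiated first and second, the
    terms with [k != j] have the entry [(0, v_j)] in the first block, which [g]
    kills; the diagonal terms give back the first derivative. *)
Lemma ps_d_lift V (g : {linear ((V * V) * (V * V))%type -> (V * V)%type}) t :
  (forall u v, g (u, v) = (u.1, v.2)) -> ps_map g (ps_d (ps_d t)) = ps_d t.
Proof.
move=> gE; apply: fps_of_inj; rewrite fps_of_map !fps_of_d; move: (fps_of t).
apply: (@fmon_ext _ _ _ (fps_map g \o (@fps_d F _ \o @fps_d F _))) => [||s].
- apply: filtered_comp (filtered_map _) _.
  exact: filtered_comp (filtered_d _) (filtered_d _).
- exact: filtered_d.
have [n [v ->]] : exists n (v : n.-tuple V), s = v.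
  by exists (size s), (in_tuple s).
rewrite /= fps_map_dd fps_d_fmon; apply: eq_bigr => j _.
rewrite (bigD1 j) // big1 => [|k kj].
  rewrite [LHS]addr0; apply: (congr1 (fun w : n.-tuple _ => fmon w)).
  apply: eq_from_tnth => i.
  by rewrite tnth_map !tnth_mktuple; case: (i == j); rewrite gE.
rewrite -fmonE (@mon_zero _ _ _ j) ?linear0 //.
by rewrite tnth_map !tnth_mktuple eqxx eq_sym (negPf kj) gE.
Qed.

(** The flip exchanges the roles of the positions [j] and [k] differentiated first
    and second. *)
Lemma ps_d_flip V
    (g : {linear ((V * V) * (V * V))%type -> ((V * V) * (V * V))%type}) t :
  (forall u v, g (u, v) = ((u.1, v.1), (u.2, v.2))) ->
  ps_map g (ps_d (ps_d t)) = ps_d (ps_d t).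
Proof.
move=> gE; apply: fps_of_inj; rewrite fps_of_map !fps_of_d; move: (fps_of t).
have ddF := filtered_comp (filtered_d (V * V)%type) (filtered_d V).
apply: (@fmon_ext _ _ _ (fps_map g \o (@fps_d F _ \o @fps_d F _))) => [||s] //.
  exact: filtered_comp (filtered_map _) ddF.
have [n [v ->]] : exists n (v : n.-tuple V), s = v.
  by exists (size s), (in_tuple s).
rewrite /= fps_map_dd fps_dd_fmon exchange_big.
apply: eq_bigr => j _; apply: eq_bigr => k _.
apply: (congr1 (fun w : n.-tuple _ => fmon w)); apply: eq_from_tnth => i.
by rewrite tnth_map !tnth_mktuple; case: (i == j); case: (i == k); rewrite gE.
Qed.

Lemma ps_eps_nat V W (f : {linear V -> W}) t :
  f (ps_eps t) = ps_eps (ps_map f t).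
Proof.
rewrite /ps_eps /ps_map.
apply: (coinv_ext (f := f \o coinv1 V) (g := coinv1 W \o coinv_map 1 f)) => v /=.
by rewrite coinv_mapE !coinv_liftE /thead tnth_mktuple.
Qed.

Lemma ps_eps_eta V (v : V) : ps_eps (ps_eta v) = v.
Proof. by rewrite /ps_eps /= coinv_liftE. Qed.

(** Setting the first block of variables to 0 in the derivative kills every
    monomial of degree at least 2, since some entry is not differentiated. *)
Lemma ps_eta_eps V (t : pseries V) : ps_eta (ps_eps t) = ps_map snd (ps_d t).
Proof.
apply/pseriesP => -[|n]; rewrite /ps_map /ps_d /=.
  (* The degree 1 part of the unit. *)
  pose m1 : {linear V -> coinv V 1} :=
    linear_of
      (fun a u v => congr1 (fun x : pseries V => x 0) (ps_eta_linear a u v)).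
  apply: (coinv_ext (f := m1 \o coinv1 V)
                    (g := coinv_map 1 snd \o coinv_d V 1)) => v /=.
  rewrite coinv_dE big_ord1 coinv_mapE coinv_liftE; congr mon.
  by apply: eq_from_tnth => k; rewrite !tnth_mktuple !ord1.
apply: esym.
apply: (coinv_ext (f := coinv_map n.+2 snd \o coinv_d V n.+2) (g := \0)).
move=> v /=; rewrite coinv_dE linear_sum big1 // => j _; rewrite coinv_mapE.
have [i ij] : exists i, i != j.
  by exists (lift j ord0); rewrite eq_sym neq_lift.
by rewrite (@mon_zero _ _ _ i) // !tnth_mktuple (negPf ij).
Qed.

End Reduced.

(** * The power series monad as a Cartesian differential comonad *)

Section PowerSeriesMonad.
Variable F : fieldType.

Lemma P_is_monad : is_monad (P_data F).
Proof.
split.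
- by move=> V W f; apply: linear_ext => s; apply: ps_mu_nat.
- by move=> V W f; apply: linear_ext => v; apply: ps_eta_nat.
- by move=> V; apply: linear_ext => t; apply: ps_mu_etal.
- by move=> V; apply: linear_ext => t; apply: ps_mu_etar.
- by move=> V; apply: linear_ext => s; apply: ps_muA.
Qed.

Lemma P_is_differential_combinator :
  is_differential_combinator (VEC_biproducts F) (P_data F) (@P_d F).
Proof.
split.
- move=> V W f; apply: linear_ext => t; apply: ps_d_nat => v;
    by apply: injective_projections; rewrite /= ?linear0 ?addr0 ?add0r.
- by move=> V; apply: linear_ext => t; apply: ps_d_zero.
- move=> V; apply: linear_ext => t; apply: ps_d_additive => v;
    by do !apply: injective_projections; rewrite /= ?addr0 ?add0r.
- by move=> V; apply: linear_ext => v; apply: ps_d_eta.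
- move=> V; apply: linear_ext => s; apply: ps_d_mu => t /=.
    by rewrite linear0 addr0.
  by rewrite linear0 add0r.
- move=> V; apply: linear_ext => t; apply: ps_d_lift => u v.
  by apply: injective_projections; rewrite /= ?addr0 ?add0r.
- move=> V; apply: linear_ext => t; apply: ps_d_flip => u v.
  by do !apply: injective_projections; rewrite /= ?addr0 ?add0r.
Qed.

Lemma P_eps_is_D_linear_unit :
  is_D_linear_unit_op (VEC_biproducts F) (P_data F) (@P_d F) (@P_eps F).
Proof.
split.
- by move=> V W f; apply: linear_ext => t; apply: ps_eps_nat.
- by move=> V; apply: linear_ext => v; apply: ps_eps_eta.
- by move=> V; apply: linear_ext => t; apply: ps_eta_eps.
Qed.

End PowerSeriesMonad.

Theorem corollary5p4 (F : fieldType) :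
  exists hP : is_cartesian_differential_comonad_op
                (VEC_biproducts F) (P_data F) (@P_d F),
    is_D_linear_unit_op (VEC_biproducts F) (P_data F) (@P_d F) (@P_eps F) /\
    exists hD : is_cartesian_differential
                  (kleisli_op_cla (proj1 hP) (VEC_biproducts F))
                  (@kleisli_op_D _ _ (proj1 hP) _ (@P_d F)),
      isomorphic_categories (D_lin_category hD) (op_category (VEC F)).
Proof.
have hP := conj (P_is_monad F) (P_is_differential_combinator F).
exists hP; split; first exact: P_eps_is_D_linear_unit.
exists (kleisli_D_cartesian_differential (proj1 hP) (proj2 hP)).
exact: (@D_lin_kleisli_op _ _ _ _ (proj1 hP) (proj2 hP) (@P_eps F)
  (P_eps_is_D_linear_unit F)).
Qed.
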